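(* Suppose that $f$ is a strictly convex self-concordant function, that for every $k$ the prolongation operator $\mathbf{P}_k$ is generated by uniform sampling without replacement as described in the context (with $\mathbf{R}_k=\mathbf{P}_k^T$), and that $\bar\varepsilon_{\min}\ne0$ and $\mu_{\min}\neq0$. Suppose also that for all $k\in\mathbb{N}$ it holds $\hat\lambda(\mathbf{x}_k)>0$ with some probability $\delta>0$, and that the sequence $(\mathbf{x}_k)_{k\in\mathbb{N}}$ is generated by $\mathbf{x}_{k+1}=\mathbf{x}_k-t_k\hat{\mathbf{Q}}_{h,k}^{-1}\nabla f(\mathbf{x}_k)$, with $t_k$ chosen by the backtracking (Armijo) line search described in the context. Then there exist constants $\hat\gamma>0$ and $\hat\eta\in\left(0,\frac{3-\sqrt5}{2}\right)$ such that: (i) if $\lambda(\mathbf{x}_k)>\hat\eta$, then $f(\mathbf{x}_{k+1})-f(\mathbf{x}_k)\le-\hat\gamma$, with probability $\delta$ at each $k\in\mathbb{N}$; (ii) if $\lambda(\mathbf{x}_k)\le\hat\eta$, then (a) if either $\bar\varepsilon\in(0,1)$ or $\mu\in(0,1)$, then $$\lambda(\mathbf{x}_{k+1})\le\frac{\sqrt{1-\bar\varepsilon_{\min}\mu_{\min}^2}+\lambda(\mathbf{x}_k)}{(1-\lambda(\mathbf{x}_k))^2}\,\lambda(\mathbf{x}_k)<\lambda(\mathbf{x}_k),$$ and thus the sequence $(\lambda(\mathbf{x}_k))_{k\in\mathbb{N}}$ achieves a composite rate, with probability $\delta$ at each $k\in\mathbb{N}$; (b) if $\bar\varepsilon=\mu=1$,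 then $$\frac{\lambda(\mathbf{x}_{k+1})}{\lambda(\mathbf{x}_k)}\le\frac{\sqrt{1-\bar\varepsilon_k\mu_k^2}+\lambda(\mathbf{x}_k)}{(1-\lambda(\mathbf{x}_k))^2},$$ and thus the sequence $(\lambda(\mathbf{x}_k))_{k\in\mathbb{N}}$ converges super-linearly, with probability $\delta$ at each $k\in\mathbb{N}$.
   Context: Function class. $f:\operatorname{dom}f\to\mathbb{R}$ with $\operatorname{dom}f\subseteq\mathbb{R}^n$ open and convex is three times continuously differentiable, strictly convex, and self-concordant with normalized constant $2$: for all $\mathbf{x}\in\operatorname{dom}f$, $\mathbf{u}\in\mathbb{R}^n$, $\phi(t)=f(\mathbf{x}+t\mathbf{u})$ satisfies $|\phi'''(t)|\le 2\,\phi''(t)^{3/2}$ for all $t$ with $\mathbf{x}+t\mathbf{u}\in\operatorname{dom}f$. Moreover $f$ has closed sublevel sets and is bounded below, so that a minimizer exists; $f=+\infty$ outside $\operatorname{dom}f$; $\mathbf{x}_0\in\operatorname{dom}f$. Random operators. Fix integers $1\le p<N<n$. At each iteration $k$ a set of $N$ indices is selected uniformly without replacement from $\{1,\dots,n\}$, with elements $s_1,\dots,s_N$; $\mathbf{P}_k\in\mathbb{R}^{n\times N}$ is the matrix whose $i$-th column is the $s_i$-th column of the identity $\mathbf{I}_{n\times n}$, and $\mathbf{R}_k:=\mathbf{P}_k^T$. Reduced Hessian. Let $\sigma_{k,1}\ge\dots\ge\sigma_{k,N}>0$ be the eigenvalues of the $N\times N$ matrix $\mathbf{R}_k\nabla^2f(\mathbf{x}_k)\mathbf{P}_k$,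 $\mathbf{\Sigma}_{k,p}=\operatorname{diag}(\sigma_{k,1},\dots,\sigma_{k,p})$, and let $\mathbf{U}_{k,p}\in\mathbb{R}^{N\times p}$ have as columns corresponding orthonormal eigenvectors. Define $$\mathbf{Q}_{H,k}^{-1}:=\sigma_{k,p+1}^{-1}\mathbf{I}_{N\times N}+\mathbf{U}_{k,p}\left(\mathbf{\Sigma}_{k,p}^{-1}-\sigma_{k,p+1}^{-1}\mathbf{I}_{p\times p}\right)\mathbf{U}_{k,p}^T,\qquad\hat{\mathbf{Q}}_{h,k}^{-1}:=\mathbf{P}_k\mathbf{Q}_{H,k}^{-1}\mathbf{R}_k,$$ and $\hat{\mathbf{d}}_{h,k}:=-\hat{\mathbf{Q}}_{h,k}^{-1}\nabla f(\mathbf{x}_k)$. Line search. With fixed $\alpha\in(0,0.5)$, $\beta\in(0,1)$: start with $t=1$; while $f(\mathbf{x}_k+t\hat{\mathbf{d}}_{h,k})>f(\mathbf{x}_k)+\alpha t\,\nabla f(\mathbf{x}_k)^T\hat{\mathbf{d}}_{h,k}$, replace $t$ by $\beta t$; then $t_k:=t$. Decrements. $\lambda(\mathbf{x}_k):=[\nabla f(\mathbf{x}_k)^T\nabla^2f(\mathbf{x}_k)^{-1}\nabla f(\mathbf{x}_k)]^{1/2}$ and $\hat\lambda(\mathbf{x}_k):=[\nabla f(\mathbf{x}_k)^T\hat{\mathbf{Q}}_{h,k}^{-1}\nabla f(\mathbf{x}_k)]^{1/2}$. Constants. $\bar\varepsilon_k:=\sigma_{k,N}/\sigma_{k,p+1}$,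 $\bar\varepsilon_{\min}:=\inf_{k}\bar\varepsilon_k$, $\bar\varepsilon:=\liminf_{k\to\infty}\bar\varepsilon_k$. For each $k$, $\mu_k\in(0,1]$ is a number such that, with probability $\delta$, $$\left(\lambda(\mathbf{x}_k)^2-\hat\lambda(\mathbf{x}_k)^2\right)^{1/2}\le\left(1-\bar\varepsilon_k\mu_k^2\right)^{1/2}\lambda(\mathbf{x}_k)$$ (such a $\mu_k$ exists under the assumption on $\hat\lambda$); $\mu:=\liminf_{k\to\infty}\mu_k$ and $\mu_{\min}:=\inf_k\mu_k$. Meaning of the probabilistic statements. ''With probability $\delta$'' at iteration $k$ (in the inequality defining $\mu_k$ and in the conclusions) means: on the event $\{\hat\lambda(\mathbf{x}_k)>0\}$, which has probability $\delta$. The quantities $\bar\varepsilon_k,\mu_k$ and those derived from them are computed along the generated sequence, and $\hat\gamma,\hat\eta$ may depend on them. The ''composite rate'' and ''super-linear'' assertions refer to the displayed per-iteration inequalities. *)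

(* Defs.v *)
From HB Require Import structures.
From mathcomp Require Import all_boot all_order all_algebra.
From mathcomp Require Import all_classical all_reals all_analysis.

Set Implicit Arguments.
Unset Strict Implicit.
Unset Printing Implicit Defensive.

Import Order.TTheory GRing.Theory Num.Theory.
Import numFieldNormedType.Exports.

Local Open Scope classical_set_scope.
Local Open Scope ring_scope.

Section Smooth.
Context {R : realType} {n : nat}.
Implicit Types (D : set 'cV[R]_n) (f : 'cV[R]_n -> R) (x : 'cV[R]_n).

Definition partial (i : 'I_n) f : 'cV[R]_n -> R :=
  fun x => 'D_(delta_mx i ord0) f x.

(* On an open set D; the values of f outside D are irrelevant. *)
Fixpoint C_on (m : nat) D f : Prop :=
  (forall x, D x -> {for x, continuous f}) /\
  (if m is m'.+1 then
     forall i : 'I_n,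
       (forall x, D x -> derivable f x (delta_mx i ord0)) /\
       C_on m' D (partial i f)
   else True).

Definition gradient f x : 'cV[R]_n := \col_i partial i f x.

Definition hessian f x : 'M[R]_n := \matrix_(i, j) partial i (partial j f) x.

Definition strictly_convex_on D f : Prop :=
  forall x y (t : R), D x -> D y -> x != y -> 0 < t < 1 ->
    f (t *: x + (1 - t) *: y) < t * f x + (1 - t) * f y.

Definition self_concordant_on D f : Prop :=
  forall x (u : 'cV[R]_n), D x ->
    let phi := fun t : R => f (x + t *: u) in
    forall t : R, D (x + t *: u) ->
      `| derive1n 3 phi t | <= 2 * (derive1n 2 phi t) `^ (3 / 2).

Definition closed_sublevel_sets D f : Prop :=
  forall a : R, closed [set x | D x /\ f x <= a].

Definition dotc (u v : 'cV[R]_n) : R := (u^T *m v) ord0 ord0.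

Definition newton_decrement f x : R :=
  Num.sqrt (dotc (gradient f x) (invmx (hessian f x) *m gradient f x)).

Definition extend_pinfty D f : 'cV[R]_n -> \bar R :=
  fun x => if `[< D x >] then (f x)%:E else +oo%E.

Definition armijo_reject D f (alpha : R) x d (t : R) : Prop :=
  ((f x + alpha * t * dotc (gradient f x) d)%:E
     < extend_pinfty D f (x + t *: d)%R)%E.

(* t is returned by the loop  t := 1; while (rejected t) t := beta * t  *)
Definition backtracking_step D f (alpha beta : R) x d (t : R) : Prop :=
  exists m : nat,
    [/\ t = beta ^+ m,
        ~ armijo_reject D f alpha x d t &
        forall j, (j < m)%N -> armijo_reject D f alpha x d (beta ^+ j)].

End Smooth.

Section Reduced.
Context {R : realType} {n N : nat}.

Definition prolongation (s : 'I_N -> 'I_n) : 'M[R]_(n, N) := colsub s 1%:M.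

Definition restriction (s : 'I_N -> 'I_n) : 'M[R]_(N, n) := (prolongation s)^T.

Definition reduced_hessian (f : 'cV[R]_n -> R) (x : 'cV[R]_n)
    (s : 'I_N -> 'I_n) : 'M[R]_N :=
  restriction s *m hessian f x *m prolongation s.

(* All the eigenvalues of M, counted with multiplicity. The sequence is
   indexed from 0: sigma`_i is the (i+1)-st largest eigenvalue. *)
Definition sorted_eigenvalues (M : 'M[R]_N) (sigma : seq R) : Prop :=
  sorted >=%R sigma /\ char_poly M = \prod_(a <- sigma) ('X - a%:P).

Definition Sigma_top (p : nat) (sigma : seq R) : 'M[R]_p :=
  diag_mx (\row_(i < p) sigma`_i).

Definition top_eigenvectors (p : nat) (M : 'M[R]_N) (sigma : seq R)
    (U : 'M[R]_(N, p)) : Prop :=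
  U^T *m U = 1%:M /\ M *m U = U *m Sigma_top p sigma.

Definition QH_inv (p : nat) (sigma : seq R) (U : 'M[R]_(N, p)) : 'M[R]_N :=
  (sigma`_p)^-1%:M +
  U *m (invmx (Sigma_top p sigma) - (sigma`_p)^-1%:M) *m U^T.

Definition Qh_inv (p : nat) (s : 'I_N -> 'I_n) (sigma : seq R)
    (U : 'M[R]_(N, p)) : 'M[R]_n :=
  prolongation s *m QH_inv sigma U *m restriction s.

Definition reduced_decrement (p : nat) (f : 'cV[R]_n -> R) (x : 'cV[R]_n)
    (s : 'I_N -> 'I_n) (sigma : seq R) (U : 'M[R]_(N, p)) : R :=
  Num.sqrt (dotc (gradient f x) (Qh_inv s sigma U *m gradient f x)).

Definition eigenvalue_ratio (p : nat) (sigma : seq R) : R :=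
  sigma`_N.-1 / sigma`_p.

End Reduced.

Section Probability.
Context {R : realType} {d : measure_display} {Omega : measurableType d}.
Variable P : probability Omega R.

Definition has_probability (E : set Omega) (q : R) : Prop :=
  measurable E /\ P E = q%:E.

(* s w lists, in an arbitrary order, a set of N indices that is uniform among
   the N-element subsets of 'I_n. *)
Definition uniform_without_replacement {n N : nat}
    (s : Omega -> 'I_N -> 'I_n) : Prop :=
  (forall w, injective (s w)) /\
  (forall A : {set 'I_n}, #|A| = N ->
     has_probability [set w | [set j in codom (s w)]%SET = A]
                     ('C(n, N)%:R)^-1).

End Probability.

(* Main.v *)
Require Import Defs.
From HB Require Import structures.
From mathcomp Require Import all_boot all_order all_algebra.
From mathcomp Require Import all_classical all_reals all_analysis.
From mathcomp Require Import ring lra.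

Set Implicit Arguments.
Unset Strict Implicit.
Unset Printing Implicit Defensive.

Import Order.TTheory GRing.Theory Num.Theory.
Import numFieldNormedType.Exports.

Local Open Scope classical_set_scope.
Local Open Scope ring_scope.

(** Probability enters only through the event that the reduced decrement is
    positive, so the theorem is about one iteration on a fixed outcome.  Write
    g and H for the gradient and the Hessian at the current point x, |v| for
    the norm of v in H, d for the coarse direction, l for the reduced
    decrement and lam for the Newton decrement; then g.d = - l^2.

    The matrix Q_H keeps the p largest eigenvalues of the reduced Hessian and
    raises the others to sigma_(p+1); hence it dominates the reduced Hessian,
    and r := |d| is at most l ([Qh_inv_energy_le]).  What has to be shown is
    that the reduced Hessian is bounded by sigma_(p+1) on the orthogonal of the
    p given eigenvectors ([rayleigh_complement_le]); this follows from its
    characteristic polynomial, once the p known roots are divided out.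

    Self-concordance bounds the third derivative on the diagonal only.  As for
    every symmetric trilinear form, the same constant serves off the diagonal:
    |D^3 f [h, v, v]| <= 2 |h| |v|^2 ([trilinear_bound]).  It must be the same
    constant, because for mu = 1 and eps = 1 the coarse direction can be the
    Newton direction and the classical quadratic rate has to come out.
    Integrating along x + t d gives, as long as t r < 1, that the segment stays
    in the domain, that Hessian norms change at most by the factor 1 - t r, and
    that the gradient at x + d differs from g + H d by at most r^2 / (1 - r) in
    the dual norm.  In that norm g + H d has square lam^2 - 2 l^2 + r^2, which
    is at most lam^2 - l^2.  With l <= lam this is [newton_decrement_step]:
    the next decrement is at most
    (sqrt (lam^2 - l^2) + lam^2 / (1 - lam)) / (1 - lam).
    The inequality that defines mu_k bounds the square root by
    sqrt (1 - eps_k mu_k^2) lam, and the composite rate follows.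

    For the other phase, a step t with t l < 1 is accepted as soon as
    t <= 2 (1 - alpha) (1 - t l)^2.  So backtracking stops at some
    t >= beta / (4 (1 + l)), and f decreases by alpha beta l^2 / (4 (1 + l)) at
    least; the definition of mu_k gives l >= sqrt (eps_min) mu_min lam, which is
    bounded below while lam > eta.  The same criterion shows that t = 1 is
    accepted when l <= (1 - 2 alpha) / 4.  The threshold eta is chosen below
    that value, below (1 - sqrt (1 - eps_min mu_min^2)) / 3 so that the factor
    of the composite rate is less than 1, and below 1/4 < (3 - sqrt 5) / 2. *)

(** * One-variable calculus *)

Section OneVariable.
Context {R : realType}.
Implicit Types (F : R -> R) (a b c h t T : R).

Lemma mean_value F (F' : R -> R) a b : a <= b ->
  (forall t, a <= t <= b -> is_derive t 1 F (F' t)) ->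
  exists2 c, a <= c <= b & F b - F a = F' c * (b - a).
Proof.
move=> ab dF; have [||c] := @MVT_segment R F F' a b ab.
- by move=> x; rewrite in_itv /= => /andP[ax xb]; apply: dF; rewrite !ltW.
- apply: derivable_within_continuous => x; rewrite in_itv /= => xab.
  by have [] := dF _ xab.
by rewrite in_itv /= => cab ->; exists c.
Qed.

Lemma mean_value_from0 F (F' : R -> R) h : (forall t, `|t| <= `|h| -> is_derive t 1 F (F' t)) ->
  exists2 c, `|c| <= `|h| & F h - F 0 = F' c * h.
Proof.
move=> dF; have [h0|h0] := leP 0 h.
  have [|c /andP[c0 ch] e] := @mean_value F F' 0 h h0.
    by move=> t /andP[t0 th]; apply: dF; rewrite !ger0_norm.
  by exists c; rewrite ?ger0_norm // e subr0.
have [|c /andP[ch c0] e] := @mean_value F F' h 0 (ltW h0).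
  by move=> t /andP[th t0]; apply: dF; rewrite !ler0_norm ?lerN2 // ltW.
by exists c; [rewrite !ler0_norm ?lerN2 // ltW | rewrite -opprB e; ring].
Qed.

Lemma le0_derive_le F (F' : R -> R) T : 0 <= T ->
  (forall t, 0 <= t <= T -> is_derive t 1 F (F' t)) ->
  (forall t, 0 <= t <= T -> F' t <= 0) -> F T <= F 0.
Proof.
move=> T0 dF F'0; have [c cT e] := mean_value T0 dF.
by rewrite -subr_le0 e subr0 mulr_le0_ge0 // F'0.
Qed.

Lemma le0_derive2_le F (F' F'' : R -> R) T : 0 <= T ->
  (forall t, 0 <= t <= T -> is_derive t 1 F (F' t)) ->
  (forall t, 0 <= t <= T -> is_derive t 1 F' (F'' t)) ->
  (forall t, 0 <= t <= T -> F'' t <= 0) -> F T <= F 0 + T * F' 0.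
Proof.
move=> T0 dF dF' F''0; have [c /andP[c0 cT] e] := mean_value T0 dF.
have {}e : F T = F 0 + F' c * T by move: e; rewrite subr0 => <-; ring.
rewrite e lerD2l mulrC ler_wpM2l //.
by apply: (@le0_derive_le F' F'') => // t /andP[t0 tc];
  [apply: dF' | apply: F''0]; rewrite t0 (le_trans tc).
Qed.

(** For the curvature chi of a self-concordant function on a line, the derivative
    of chi^(-1/2) is - chi' / (2 chi^(3/2)), which is at least -1. *)
Lemma inv_sqrt_decay (chi chi' : R -> R) T : 0 <= T ->
  (forall t, 0 <= t <= T -> is_derive t 1 chi (chi' t)) ->
  (forall t, 0 <= t <= T -> 0 < chi t) ->
  (forall t, 0 <= t <= T -> chi' t <= 2 * Num.sqrt (chi t) ^+ 3) ->
  (Num.sqrt (chi 0))^-1 - T <= (Num.sqrt (chi T))^-1.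
Proof.
move=> T0 dchi chi0 bchi.
pose F t := - (Num.sqrt (chi t))^-1 - t.
pose F' t := (Num.sqrt (chi t)) ^- 2 * ((2 * Num.sqrt (chi t))^-1 * chi' t) - 1.
have : F T <= F 0.
  apply: (@le0_derive_le F F') => // t tT.
    have s0 : Num.sqrt (chi t) != 0 by rewrite gt_eqF // sqrtr_gt0 chi0.
    have d1 := dchi t tT.
    have d2 : is_derive t 1 (fun u => Num.sqrt (chi u)) ((2 * Num.sqrt (chi t))^-1 * chi' t).
      by apply: (@is_derive1_comp R Num.sqrt chi); apply: is_derive1_sqrt; exact: chi0.
    have d3 := @is_deriveV R (fun u => Num.sqrt (chi u)) _ _ _ s0 d2.
    have -> : F' t = - (- Num.sqrt (chi t) ^- 2 *: ((2 * Num.sqrt (chi t))^-1 * chi' t)) - 1.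
      by rewrite /F' /GRing.scale /= mulNr opprK.
    have -> : F = (- (fun y => (Num.sqrt (chi y))^-1)) - id by [].
    exact: is_deriveB.
  have s0 : 0 < Num.sqrt (chi t) by rewrite sqrtr_gt0 chi0.
  rewrite /F' subr_le0; apply: (@le_trans _ _
    (Num.sqrt (chi t) ^- 2 * ((2 * Num.sqrt (chi t))^-1 * (2 * Num.sqrt (chi t) ^+ 3)))).
    by rewrite !ler_wpM2l ?bchi // invr_ge0 ?exprn_ge0 ?mulr_ge0 // ltW.
  by rewrite le_eqVlt; apply/orP; left; apply/eqP; field; rewrite gt_eqF.
by rewrite /F; lra.
Qed.

Lemma curvature_growth (chi chi' : R -> R) (r T : R) : 0 <= T -> 0 < r ->
  chi 0 = r ^+ 2 ->
  (forall t, 0 <= t <= T -> is_derive t 1 chi (chi' t)) ->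
  (forall t, 0 <= t <= T -> 0 < chi t) ->
  (forall t, 0 <= t <= T -> chi' t <= 2 * Num.sqrt (chi t) ^+ 3) ->
  T * r < 1 -> chi T <= (r / (1 - T * r)) ^+ 2.
Proof.
move=> T0 r0 chi0 dchi chi_gt0 bchi Tr; have := inv_sqrt_decay T0 dchi chi_gt0 bchi.
have chiT : 0 < chi T by rewrite chi_gt0 // lexx andbT.
have s0 : 0 < Num.sqrt (chi T) by rewrite sqrtr_gt0.
rewrite -{2}(sqr_sqrtr (ltW chiT)) chi0 sqrtr_sqr gtr0_norm //.
move: (Num.sqrt (chi T)) s0 => s s0.
have -> : r^-1 - T = (1 - T * r) / r by field; rewrite gt_eqF.
rewrite -[(1 - _) / r]invf_div lef_pV2 ?posrE ?divr_gt0 ?subr_gt0 // => H.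
by rewrite lerXn2r ?nnegrE ?divr_ge0 ?subr_ge0 // ltW.
Qed.

Lemma is_derive_addcst F (c t l : R) :
  is_derive t 1 F l -> is_derive t 1 (fun u => F u + c) l.
Proof. by move=> dF; have := is_deriveD dF (is_derive_cst c t 1); rewrite addr0. Qed.

Lemma is_derive_1Bmul (r t : R) : is_derive t 1 (fun s : R => 1 - s * r) (- r).
Proof.
have := is_derive_addcst 1 (is_deriveZ (- r) (is_derive_id t 1)).
rewrite [_%:A]mulr1; congr is_derive.
by apply/funext => s; rewrite -[LHS]/(- r * s + 1); ring.
Qed.

Lemma is_derive_1Bmul_inv (r t : R) : 1 - t * r != 0 ->
  is_derive t 1 (fun s : R => (1 - s * r)^-1) (r * (1 - t * r) ^- 2).
Proof.
move=> nz; have := @is_deriveV R _ t _ _ nz (is_derive_1Bmul r t).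
by rewrite /GRing.scale /= mulrNN mulrC.
Qed.

End OneVariable.
(** * Directional derivatives *)

Section SeveralVariables.
Context {R : realType} {n : nat}.
Implicit Types (D : set 'cV[R]_n) (f g : 'cV[R]_n -> R) (x y u v w : 'cV[R]_n).

Lemma is_derive_cvg f x v (l : R) :
  is_derive x v f l <->
  (fun h : R => h^-1 * (f (h *: v + x) - f x)) @ 0^' --> l.
Proof.
split=> [[df <-]|c]; first exact: df.
by split; [apply/cvg_ex; exists l | exact: cvg_lim].
Qed.

Lemma is_derive_line f x u (t l : R) :
  is_derive (x + t *: u) u f l ->
  is_derive t 1 (fun t : R => f (x + t *: u)) l.
Proof.
have e : (fun h : R => h^-1 *:
    (((fun t : R => f (x + t *: u)) \o shift t) (h *: (1:R)) - f (x + t *: u)))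
  = (fun h : R => h^-1 *: ((f \o shift (x + t *: u)) (h *: u) - f (x + t *: u))).
  by apply/funext => h /=; rewrite [_%:A]mulr1 scalerDl addrCA.
by move=> [df dl]; split; [rewrite /derivable e | rewrite /derive e].
Qed.

(** Linearity of the directional derivative needs only one of the two
    derivatives to be continuous: along the second direction the mean value
    theorem produces a value of g near y. *)
Lemma is_derive_add f (g : 'cV[R]_n -> R) y v e (c l : R) :
  is_derive y v f l -> (\near y, is_derive y e f (g y)) ->
  {for y, continuous g} -> is_derive y (v + c *: e) f (l + c * g y).
Proof.
move=> /is_derive_cvg dv de gc; apply/is_derive_cvg.
have -> : (fun h : R => h^-1 * (f (h *: (v + c *: e) + y) - f y)) =
  (fun h : R => h^-1 * (f (h *: v + y) - f y) +
    h^-1 * (f (h *: (v + c *: e) + y) - f (h *: v + y))).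
  by apply/funext => h; rewrite -mulrDr; congr (_ * _); ring.
apply: cvgD => //; apply/cvgrPdist_le => eps eps0.
(* the points used below are at distance at most `|h| * K from y *)
pose K := `|v| + `|c| * `|e| + 1.
have K0 : 0 < K by rewrite ltr_wpDl // addr_ge0 // mulr_ge0.
have e'0 : 0 < eps / (`|c| + 1) by rewrite divr_gt0 // ltr_wpDl.
move/cvgrPdist_le: gc => /(_ _ e'0) gc.
have [del /= del0 hdel] : nbhs_ball y
    [set z | is_derive z e f (g z) /\ `|g y - g z| <= eps / (`|c| + 1)].
  by apply/nbhs_ballP; near=> z; split; near: z.
have dK0 : 0 < del / K by rewrite divr_gt0.
near=> h.
have h0 : h != 0 by near: h; exact: nbhs_dnbhs_neq.
have hd : `|h| < del / K by near: h; exact: dnbhs0_lt.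
have inb s : `|s| <= `|h * c| -> ball y del ((h *: v + y) + s *: e).
  move=> sh; rewrite -ball_normE /= distrC [h *: v + y + _]addrAC addrK.
  apply: le_lt_trans (ler_normD _ _) _; rewrite !normrZ.
  apply: (@le_lt_trans _ _ (`|h| * K)); last by rewrite -ltr_pdivlMr.
  rewrite /K !mulrDr mulrA -normrM mulr1 addrAC.
  rewrite -[leLHS]addr0 addrC [leRHS]addrC -!addrA.
  by have := ler_wpM2r (normr_ge0 e) sh; have := normr_ge0 h; lra.
have [|s sh es] := @mean_value_from0 R (fun s => f ((h *: v + y) + s *: e))
  (fun s => g ((h *: v + y) + s *: e)) (h * c).
  by move=> s sh; apply: is_derive_line; have [] := hdel _ (inb _ sh).
rewrite scale0r addr0 in es.
rewrite scalerDr scalerA -addrA [_ + y]addrC addrA es mulrCA mulKf // mulrC -mulrBl normrM.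
have [_ gs] := hdel _ (inb _ sh).
rewrite mulrC; apply: le_trans (ler_wpM2l (normr_ge0 c) gs) _.
rewrite [X in X <= _]mulrCA ler_piMr ?(ltW eps0) // ler_pdivrMr ?mul1r ?lerDl ?ltr_wpDl.
Unshelve. all: by end_near. Qed.

Fact dirder_key : unit. Proof. exact: tt. Qed.

(** An explicit sum of partial derivatives: it is linear in v without any
    hypothesis on f.  It is locked so that comparing two base points never
    unfolds the partial derivatives. *)
Definition dirder v f : 'cV[R]_n -> R :=
  locked_with dirder_key (fun y => \sum_i v i ord0 * partial i f y).

Lemma dirderE v f : dirder v f = fun y => \sum_i v i ord0 * partial i f y.
Proof. exact: unlock. Qed.

Lemma dirderDZ v u (a : R) f y :
  dirder (a *: v + u) f y = a * dirder v f y + dirder u f y.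
Proof.
rewrite !dirderE mulr_sumr -big_split /=; apply: eq_bigr => i _.
by rewrite !mxE; ring.
Qed.

Lemma C_onW m D f : C_on m.+1 D f -> C_on m D f.
Proof.
elim: m f => [|m IH] f [fc df]; split=> // i.
by have [? ?] := df i; split => //; exact: IH.
Qed.

(** The coordinates of v are added one at a time, each by [is_derive_add]. *)
Lemma is_derive_dirder D f y v : open D -> C_on 1 D f -> D y ->
  is_derive y v f (dirder v f y).
Proof.
move=> Do [_ fd] Dy.
have nD : \near y, D y by apply: open_nbhs_nbhs.
suff H (s : seq 'I_n) : is_derive y (\sum_(i <- s) v i ord0 *: delta_mx i ord0) f
   (\sum_(i <- s) v i ord0 * partial i f y).
  have ev : v = \sum_i v i ord0 *: delta_mx i ord0.
    by rewrite {1}[v]matrix_sum_delta; apply: eq_bigr => i _; rewrite big_ord1.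
  by rewrite dirderE [X in is_derive _ X]ev; exact: H.
elim: s => [|i s IH].
  rewrite !big_nil; split; [exact: derivable0|exact: derive0].
rewrite !big_cons addrC [X in is_derive _ _ _ X]addrC; apply: is_derive_add => //.
- near=> z; have Dz : D z by near: z.
  by apply: derivableP; have [+ _] := fd i; apply.
- by have [_ [+ _]] := fd i; apply.
Unshelve. all: by end_near. Qed.

End SeveralVariables.

Section Schwarz.
Context {R : realType} {n : nat}.
Implicit Types (D : set 'cV[R]_n) (f g : 'cV[R]_n -> R) (x y u v w : 'cV[R]_n).

Lemma open_near_eq D f g x : open D -> D x -> (forall x, D x -> f x = g x) ->
  \near x, f x = g x.
Proof.
move=> Do Dx fg; near=> z; apply: fg; near: z; exact: open_nbhs_nbhs.
Unshelve. all: by end_near. Qed.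

Lemma C_on_ext m D f g : open D -> (forall x, D x -> f x = g x) ->
  C_on m D f -> C_on m D g.
Proof.
move=> Do; elim: m f g => [|m IH] f g fg [fc df].
  split=> // x Dx; rewrite /prop_for /continuous_at -(fg x Dx).
  exact: cvg_trans (near_eq_cvg (open_near_eq Do Dx fg)) (fc x Dx).
split=> [x Dx|i].
  rewrite /prop_for /continuous_at -(fg x Dx).
  exact: cvg_trans (near_eq_cvg (open_near_eq Do Dx fg)) (fc x Dx).
have [di ci] := df i; split=> [x Dx|].
  by apply: near_eq_derivable (di x Dx); exact: (open_near_eq Do Dx fg).
by apply: IH ci => x Dx; apply: near_eq_derive; exact: (open_near_eq Do Dx fg).
Qed.

Lemma C_onDZ m D f g (c : R) : open D -> C_on m D f -> C_on m D g ->
  C_on m D (fun x => c * f x + g x).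
Proof.
move=> Do; elim: m f g => [|m IH] f g [fc df] [gc dg].
  split=> // x Dx.
  by apply: continuousD; [apply: continuousM; [exact: cst_continuous|exact: fc]|exact: gc].
split=> [x Dx|i].
  by apply: continuousD; [apply: continuousM; [exact: cst_continuous|exact: fc]|exact: gc].
have [fd pf] := df i; have [gd pg] := dg i.
have dd x : D x -> is_derive x (delta_mx i ord0) (fun x => c * f x + g x)
    (c * partial i f x + partial i g x).
  move=> Dx; have ff := derivableP (fd x Dx); have gg := derivableP (gd x Dx).
  exact: (is_deriveD (is_deriveZ c ff) gg).
split=> [x Dx|]; first by have [] := dd x Dx.
apply: C_on_ext (IH _ _ pf pg) => // x Dx.
by have [_ <-] := dd x Dx.
Qed.

Lemma C_on0 m D : C_on m D (fun=> 0).
Proof.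
have c0 (x : 'cV[R]_n) : {for x, continuous (fun=> 0 : R)} by exact: cst_continuous.
elim: m => [|m IH]; split=> // i; split=> [x _|]; first exact: derivable_cst.
rewrite (_ : partial i _ = fun=> 0) //.
by apply/funext => x; exact: derive_cst.
Qed.

Lemma C_on_dirder m D f v : open D -> C_on m.+1 D f -> C_on m D (dirder v f).
Proof.
move=> Do [_ df]; rewrite dirderE.
suff H (s : seq 'I_n) : C_on m D (fun y => \sum_(i <- s) v i ord0 * partial i f y) by exact: H.
elim: s => [|i s IH].
  by rewrite (_ : (fun _ => _) = fun=> 0); [exact: C_on0|apply/funext => y; rewrite big_nil].
rewrite (_ : (fun _ => _) = fun y =>
  v i ord0 * partial i f y + \sum_(i <- s) v i ord0 * partial i f y); last first.
  by apply/funext => y; rewrite big_cons.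
by apply: C_onDZ => //; have [_ ?] := df i.
Qed.

Lemma eq_on_dirder D f g v y : open D -> (forall x, D x -> f x = g x) -> D y ->
  dirder v f y = dirder v g y.
Proof.
move=> Do fg Dy; rewrite !dirderE; apply: eq_bigr => i _; congr (_ * _).
apply: near_eq_derive; near=> z; apply: fg; near: z; exact: open_nbhs_nbhs.
Unshelve. all: by end_near. Qed.

(** Two applications of the mean value theorem write the second difference as
    h^2 times a mixed derivative at a nearby point.  The difference is symmetric
    in u and v, which is why mixed derivatives commute. *)
Lemma cvg_second_difference D f y u v : open D -> C_on 2 D f -> D y ->
  (fun h : R => (f (y + h *: u + h *: v) - f (y + h *: u)
                 - (f (y + h *: v) - f y)) / h ^+ 2) @ 0^'
  --> dirder v (dirder u f) y.
Proof.
move=> Do f2 Dy; have f1 := C_onW f2.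
have u1 : C_on 1 D (dirder u f) by exact: C_on_dirder.
have [uvc _] : C_on 0 D (dirder v (dirder u f)) by exact: C_on_dirder.
apply/cvgrPdist_le => eps eps0.
move/cvgrPdist_le: (uvc y Dy) => /(_ _ eps0) gc.
pose K := `|u| + `|v| + 1.
have K0 : 0 < K by rewrite ltr_wpDl // addr_ge0.
have [del /= del0 hdel] : nbhs_ball y
    [set z | D z /\ `|dirder v (dirder u f) y - dirder v (dirder u f) z| <= eps].
  by apply/nbhs_ballP; near=> z; split; near: z; [exact: open_nbhs_nbhs | exact: gc].
have dK0 : 0 < del / K by rewrite divr_gt0.
near=> h.
have h0 : h != 0 by near: h; exact: nbhs_dnbhs_neq.
have hd : `|h| < del / K by near: h; exact: dnbhs0_lt.
have inb (a b : R) : `|a| <= `|h| -> `|b| <= `|h| -> ball y del (y + a *: u + b *: v).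
  move=> ah bh; rewrite -ball_normE /= distrC -[_ + a *: u + _]addrA [y + _]addrC addrK.
  apply: le_lt_trans (ler_normD _ _) _; rewrite !normrZ.
  apply: (@le_lt_trans _ _ (`|h| * K)); last by rewrite -ltr_pdivlMr.
  have := ler_wpM2r (normr_ge0 u) ah; have := ler_wpM2r (normr_ge0 v) bh.
  by have := normr_ge0 h; rewrite /K !mulrDr; lra.
have inD (a b : R) : `|a| <= `|h| -> `|b| <= `|h| -> D (y + a *: u + b *: v).
  by move=> ah bh; have [] := hdel _ (inb _ _ ah bh).
have n0 : `|0 : R| <= `|h| by rewrite normr0.
pose F := (fun s : R => f ((y + h *: v) + s *: u)) - (fun s : R => f (y + s *: u)).
have [|s sh es] := @mean_value_from0 R F
   (fun s => dirder u f ((y + h *: v) + s *: u) - dirder u f (y + s *: u)) h.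
  move=> s sh; apply: is_deriveB; apply: is_derive_line; apply: is_derive_dirder Do f1 _.
    by rewrite addrAC; exact: inD.
  by rewrite -[X in D X]addr0 -(scale0r v); exact: inD.
have [|b bh eb] := @mean_value_from0 R (fun b => dirder u f (y + s *: u + b *: v))
   (fun b => dirder v (dirder u f) (y + s *: u + b *: v)) h.
  by move=> b bh; apply: is_derive_line; apply: is_derive_dirder Do u1 _; exact: inD.
have -> : f (y + h *: u + h *: v) - f (y + h *: u) - (f (y + h *: v) - f y) =
    dirder v (dirder u f) (y + s *: u + b *: v) * h * h.
  rewrite -eb scale0r addr0 [y + s *: u + _]addrAC -es.
  rewrite -[F h]/(f (y + h *: v + h *: u) - f (y + h *: u)).
  rewrite -[F 0]/(f (y + h *: v + 0 *: u) - f (y + 0 *: u)).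
  by rewrite scale0r !addr0 [y + h *: v + _]addrAC.
rewrite expr2 invfM mulrA mulfK // mulfK //.
by have [] := hdel _ (inb _ _ sh bh).
Unshelve. all: by end_near. Qed.

Lemma dirderC D f y u v : open D -> C_on 2 D f -> D y ->
  dirder u (dirder v f) y = dirder v (dirder u f) y.
Proof.
move=> Do f2 Dy; have c1 := @cvg_second_difference D f y u v Do f2 Dy.
have := @cvg_second_difference D f y v u Do f2 Dy.
rewrite (_ : (fun _ => _) = (fun h : R => (f (y + h *: u + h *: v) - f (y + h *: u)
                 - (f (y + h *: v) - f y)) / h ^+ 2)); last first.
  by apply/funext => h; congr (_ / _); rewrite [y + h *: v + _]addrAC; ring.
by move=> c2; apply: cvg_unique c2 c1.
Qed.

End Schwarz.

(** * Binary cubic forms *)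

Section CubicForms.
Context {R : realType}.

(** With (a, b) = rho (cos phi, sin phi), take c and s to be the cosine and sine
    of phi / 3; the two polynomials are those of the triple angle. *)
Lemma trisection (a b : R) : exists c s : R,
  [/\ c ^+ 2 + s ^+ 2 = 1,
      a = Num.sqrt (a ^+ 2 + b ^+ 2) * (c ^+ 3 - 3 * c * s ^+ 2)
    & b = Num.sqrt (a ^+ 2 + b ^+ 2) * (3 * c ^+ 2 * s - s ^+ 3)].
Proof.
set rho := Num.sqrt _.
have rho2 : rho ^+ 2 = a ^+ 2 + b ^+ 2 by rewrite sqr_sqrtr // addr_ge0 ?sqr_ge0.
have [rho0|rho_neq0] := eqVneq rho 0.
  exists 1, 0; rewrite rho0 !mul0r; move: rho2; rewrite rho0 expr0n /= => /esym/eqP.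
  by rewrite paddr_eq0 ?sqr_ge0 // !sqrf_eq0 => /andP[/eqP-> /eqP->]; split => //; ring.
have rho_gt0 : 0 < rho by rewrite lt_neqAle eq_sym rho_neq0 sqrtr_ge0.
have [phi [cphi sphi]] : exists phi : R, rho * cos phi = a /\ rho * sin phi = b.
  have aI : -1 <= a / rho <= 1.
    rewrite -ler_norml normrM normfV (gtr0_norm rho_gt0) ler_pdivrMr // mul1r.
    rewrite -(ler_pXn2r (n := 2)) ?nnegrE ?normr_ge0 ?(ltW rho_gt0) //.
    by rewrite real_normK ?num_real // rho2 lerDl; exact: sqr_ge0.
  have e1 : rho * cos (acos (a / rho)) = a by rewrite acosK ?in_itv /= ?aI // mulrC divfK.
  have e2 : rho * sin (acos (a / rho)) = `|b|.
    rewrite sin_acos //.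
    rewrite -[X in X * _](gtr0_norm rho_gt0) -sqrtr_sqr -sqrtrM ?sqr_ge0 //.
    rewrite -sqrtr_sqr; congr Num.sqrt.
    rewrite mulrBr mulr1 expr_div_n mulrCA divff ?expf_neq0 // mulr1 rho2; ring.
  have [b0|b0] := leP 0 b; first by exists (acos (a / rho)); rewrite e1 e2 ger0_norm.
  by exists (- acos (a / rho)); rewrite cosN sinN mulrN e1 e2 ltr0_norm // opprK.
exists (cos (phi / 3)), (sin (phi / 3)); split; first exact: cos2Dsin2.
- rewrite -{1}cphi; congr (_ * _).
  have -> : phi = phi / 3 + phi / 3 + phi / 3 by field.
  by rewrite !cosD !sinD (_ : (phi / 3 + phi / 3 + phi / 3) / 3 = phi / 3); [ring|field].
- rewrite -{1}sphi; congr (_ * _).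
  have -> : phi = phi / 3 + phi / 3 + phi / 3 by field.
  by rewrite !(sinD, cosD) (_ : (phi / 3 + phi / 3 + phi / 3) / 3 = phi / 3); [ring|field].
Qed.

(** For r = sqrt 3 or - sqrt 3, (c1, s1) is (c, s) turned by a third of a full
    turn, in one or the other direction; this does not change the triple angle. *)
Lemma trisection_rotate (r c s : R) : r ^+ 2 = 3 ->
  let c1 := - (c + r * s) / 2 in let s1 := (r * c - s) / 2 in
  [/\ c1 ^+ 2 + s1 ^+ 2 = c ^+ 2 + s ^+ 2,
      c1 ^+ 3 - 3 * c1 * s1 ^+ 2 = c ^+ 3 - 3 * c * s ^+ 2
    & 3 * c1 ^+ 2 * s1 - s1 ^+ 3 = 3 * c ^+ 2 * s - s ^+ 3].
Proof.
move=> /eqP; rewrite -subr_eq0 => /eqP r3 c1 s1; split; apply/eqP; rewrite -subr_eq0; apply/eqP.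
- transitivity ((r ^+ 2 - 3) * ((c ^+ 2 + s ^+ 2) / 4)).
    by rewrite /c1 /s1; field.
  by rewrite r3 mul0r.
- transitivity ((r ^+ 2 - 3) * (- c * s ^+ 2 - (c + r * s) * (s ^+ 2 - 3 * c ^+ 2) / 8)).
    by rewrite /c1 /s1; field.
  by rewrite r3 mul0r.
- transitivity ((r ^+ 2 - 3) * (c ^+ 2 * s + (r * c - s) * (3 * s ^+ 2 - c ^+ 2) / 8)).
    by rewrite /c1 /s1; field.
  by rewrite r3 mul0r.
Qed.

(** Szego's inequality p(0)^2 + (p'(0) / 3)^2 <= max p^2 for the trigonometric
    polynomial p given by a binary cubic form.  If (a0, a1) has polar angle
    3 theta, the form at angle theta exceeds sqrt (a0^2 + a1^2) by sin(theta)^2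
    times a linear form in (cos theta, sin theta).  The three possible theta
    differ by thirds of a turn, so the three values of the linear form add up
    to 0 and one of them is nonnegative. *)
Lemma cubic_form_sqrt_le (a0 a1 a2 a3 K : R) :
  (forall c s : R, c ^+ 2 + s ^+ 2 = 1 ->
    a0 * c ^+ 3 + 3 * a1 * c ^+ 2 * s + 3 * a2 * c * s ^+ 2 + a3 * s ^+ 3 <= K) ->
  Num.sqrt (a0 ^+ 2 + a1 ^+ 2) <= K.
Proof.
move=> bK; set rho := Num.sqrt _.
have rho2 : rho ^+ 2 = a0 ^+ 2 + a1 ^+ 2 by rewrite sqr_sqrtr // addr_ge0 ?sqr_ge0.
have [c [s [cs1 ea eb]]] := trisection a0 a1; rewrite -/rho in ea eb.
(* at a node, the cubic form exceeds rho by s^2 times a linear form *)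
(* a node is a unit vector (x, y) whose triple angle is that of (a0, a1) *)
have node x y : x ^+ 2 + y ^+ 2 = 1 ->
    a0 = rho * (x ^+ 3 - 3 * x * y ^+ 2) -> a1 = rho * (3 * x ^+ 2 * y - y ^+ 3) ->
    0 <= 3 * (a0 + a2) * x + (a1 + a3) * y -> rho <= K.
  move=> xy1 e0 e1 pos; apply: le_trans (bK x y xy1).
  have rhoE : rho = a0 * (x ^+ 3 - 3 * x * y ^+ 2) + a1 * (3 * x ^+ 2 * y - y ^+ 3).
    have XY : (x ^+ 3 - 3 * x * y ^+ 2) ^+ 2 + (3 * x ^+ 2 * y - y ^+ 3) ^+ 2 = 1.
      by transitivity ((x ^+ 2 + y ^+ 2) ^+ 3); [ring|rewrite xy1 expr1n].
    have H X Y : X ^+ 2 + Y ^+ 2 = 1 -> a0 = rho * X -> a1 = rho * Y -> rho = a0 * X + a1 * Y.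
      by move=> XY1 -> ->; rewrite -!mulrA -mulrDr -!expr2 XY1 mulr1.
    exact: H.
  rewrite {1}rhoE -subr_ge0.
  have -> : a0 * x ^+ 3 + 3 * a1 * x ^+ 2 * y + 3 * a2 * x * y ^+ 2 + a3 * y ^+ 3 -
     (a0 * (x ^+ 3 - 3 * x * y ^+ 2) + a1 * (3 * x ^+ 2 * y - y ^+ 3)) =
     y ^+ 2 * (3 * (a0 + a2) * x + (a1 + a3) * y) by ring.
  by rewrite mulr_ge0 ?sqr_ge0.
pose r : R := Num.sqrt 3.
have r3 : r ^+ 2 = 3 by rewrite sqr_sqrtr.
have r3' : (- r) ^+ 2 = 3 by rewrite sqrrN.
have [p1 q1 t1] := trisection_rotate c s r3.
have [p2 q2 t2] := trisection_rotate c s r3'.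
(* the linear form takes three values of sum zero at the nodes *)
have [?|n0] := leP 0 (3 * (a0 + a2) * c + (a1 + a3) * s); first exact: (node c s).
have [?|n1] := leP 0 (3 * (a0 + a2) * (- (c + r * s) / 2) + (a1 + a3) * ((r * c - s) / 2)).
  by apply: node (etrans p1 cs1) _ _ _; rewrite ?q1 ?t1.
apply: node (etrans p2 cs1) _ _ _; rewrite ?q2 ?t2 //.
by lra.
Qed.

End CubicForms.

(** * Symmetric trilinear forms *)

Section Forms.
Context {R : realType} {V : lmodType R}.
Implicit Types (u v w : V) (a b c : R).

Definition semi_inner (q : V -> V -> R) : Prop :=
  [/\ forall a u v w, q (a *: u + v) w = a * q u w + q v w,
      forall u v, q u v = q v u & forall u, 0 <= q u u].

Section SemiInner.
Variable q : V -> V -> R.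
Hypothesis q_inner : semi_inner q.

Let qDZ : forall a u v w, q (a *: u + v) w = a * q u w + q v w.
Proof. by case: q_inner. Qed.
Let qC : forall u v, q u v = q v u.
Proof. by case: q_inner. Qed.
Let q_ge0 : forall u, 0 <= q u u.
Proof. by case: q_inner. Qed.

Lemma semi_innerDl u v w : q (u + v) w = q u w + q v w.
Proof. by rewrite -{1}(scale1r u) qDZ mul1r. Qed.

Lemma semi_inner0l w : q 0 w = 0.
Proof. by have := semi_innerDl 0 0 w; rewrite addr0; lra. Qed.

Lemma semi_innerZl a u w : q (a *: u) w = a * q u w.
Proof. by rewrite -[a *: u]addr0 qDZ semi_inner0l addr0. Qed.

Lemma semi_innerDr u v w : q w (u + v) = q w u + q w v.
Proof. by rewrite ![q w _]qC semi_innerDl. Qed.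

Lemma semi_innerZr a u w : q w (a *: u) = a * q w u.
Proof. by rewrite ![q w _]qC semi_innerZl. Qed.

(** The nonnegative quadratic a^2 q(u, u) + 2 a b q(u, v) + b^2 q(v, v) is
    evaluated at a = - q(u, v), b = q(u, u) if u is not isotropic; otherwise its
    linear part in a has to vanish. *)
Lemma semi_inner_cauchy_sqr u v : q u v ^+ 2 <= q u u * q v v.
Proof.
have quad a b : 0 <= a ^+ 2 * q u u + 2 * a * b * q u v + b ^+ 2 * q v v.
  have := q_ge0 (a *: u + b *: v).
  by rewrite !(semi_innerDl, semi_innerDr, semi_innerZl, semi_innerZr) (qC v u); lra.
have [u0|u_gt0] := leP (q u u) 0.
  have {}u0 : q u u = 0 by apply/eqP; rewrite eq_le u0 q_ge0.
  have [->|uv0] := eqVneq (q u v) 0; first by rewrite expr0n u0 mul0r.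
  have := quad (- (q v v + 1) / (2 * q u v)) 1; rewrite u0.
  have -> : 2 * (- (q v v + 1) / (2 * q u v)) * 1 * q u v = - (q v v + 1) by field.
  by lra.
have := quad (- q u v) (q u u).
have -> : (- q u v) ^+ 2 * q u u + 2 * - q u v * q u u * q u v + q u u ^+ 2 * q v v
  = q u u * (q u u * q v v - q u v ^+ 2) by ring.
by rewrite pmulr_rge0 // subr_ge0.
Qed.

Lemma semi_inner_cauchy u v : q u v <= Num.sqrt (q u u) * Num.sqrt (q v v).
Proof.
rewrite -sqrtrM ?q_ge0 //; apply: le_trans (ler_norm _) _.
by rewrite -sqrtr_sqr ler_wsqrtr // semi_inner_cauchy_sqr.
Qed.

End SemiInner.

(** Banach's theorem that a symmetric multilinear form has the same norm as its
    restriction to the diagonal, in the case needed here.  Only the plane of h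
    and v matters; in an orthonormal basis (e, f) of it with e along v, the form
    is a binary cubic, h = B e + W f, and T(h, e, e) = B T(e, e, e) + W T(f, e, e)
    is bounded by Cauchy-Schwarz and [cubic_form_sqrt_le]. *)
Lemma trilinear_bound (q : V -> V -> R) (T : V -> V -> V -> R) K :
  semi_inner q -> (forall u, q u u = 0 -> u = 0) ->
  (forall a u v w z, T (a *: u + v) w z = a * T u w z + T v w z) ->
  (forall u v w, T u v w = T v u w) -> (forall u v w, T u v w = T u w v) ->
  (forall u, T u u u <= K * Num.sqrt (q u u) ^+ 3) ->
  forall h v, T h v v <= K * Num.sqrt (q h h) * q v v.
Proof.
move=> q_inner q_def T_lin T12 T23 T_diag h v.
have qC u w : q u w = q w u by case: q_inner.
have q_ge0 u : 0 <= q u u by case: q_inner.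
have qE := (semi_innerDl q_inner, semi_innerDr q_inner, semi_innerZl q_inner, semi_innerZr q_inner).
have TD u w y z : T (u + w) y z = T u y z + T w y z by rewrite -{1}(scale1r u) T_lin mul1r.
have T0 y z : T 0 y z = 0 by have := TD 0 0 y z; rewrite addr0; lra.
have TZ a u y z : T (a *: u) y z = a * T u y z by rewrite -[a *: u]addr0 T_lin T0 addr0.
have TD2 u w y z : T u (w + y) z = T u w z + T u y z by rewrite ![T u _ z]T12 TD.
have TZ2 a u y z : T u (a *: y) z = a * T u y z by rewrite ![T u _ z]T12 TZ.
have TD3 u w y z : T u w (y + z) = T u w y + T u w z by rewrite ![T u w _]T23 TD2.
have TZ3 a u y z : T u y (a *: z) = a * T u y z by rewrite ![T u y _]T23 TZ2.
have TE := (TD, TD2, TD3, TZ, TZ2, TZ3).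
have K_ge0 u : u != 0 -> 0 <= K.
  move=> u0; have s0 : 0 < Num.sqrt (q u u).
    by rewrite sqrtr_gt0 lt_neqAle q_ge0 andbT eq_sym; apply: contraNneq u0 => /q_def ->.
  have := T_diag u; have := T_diag (- u).
  rewrite -scaleN1r !qE !TE !mulN1r !opprK => t1 t2.
  have : 0 <= K * Num.sqrt (q u u) ^+ 3 by lra.
  by rewrite pmulr_lge0 // exprn_gt0.
have [->|v0] := eqVneq v 0; first by rewrite -(scale0r v) !TE !qE; lra.
have normalize u : u != 0 -> exists e, q e e = 1 /\ u = Num.sqrt (q u u) *: e.
  move=> u0; have s0 : Num.sqrt (q u u) != 0.
    by rewrite gt_eqF // sqrtr_gt0 lt_neqAle q_ge0 andbT eq_sym; apply: contraNneq u0 => /q_def ->.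
  exists ((Num.sqrt (q u u))^-1 *: u); rewrite scalerA divff // scale1r; split => //.
  by rewrite !qE mulrA -expr2 exprVn -[X in _ * X](sqr_sqrtr (q_ge0 u)) mulVf // expf_neq0.
(* both sides are homogeneous of degree 2 in v *)
suff H e : q e e = 1 -> T h e e <= K * Num.sqrt (q h h).
  have [e [e1 vE]] := normalize v v0.
  have -> : T h v v = Num.sqrt (q v v) ^+ 2 * T h e e.
    by rewrite {1 2}vE !TE mulrA -expr2.
  by rewrite sqr_sqrtr // mulrC ler_wpM2r // H.
move=> e1; pose B := q h e; pose w := h - B *: e.
have hE : h = B *: e + w by rewrite addrC subrK.
have we : q w e = 0 by rewrite /w -scaleNr !qE e1 /B; ring.
have KK := K_ge0 v v0.
have [w0|w0] := eqVneq w 0.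
  rewrite hE w0 addr0 !TE !qE e1 mulr1 -expr2 sqrtr_sqr.
  have := T_diag e; rewrite e1 sqrtr1 expr1n mulr1 => t1.
  have := T_diag (- e); rewrite -scaleN1r !TE !qE e1 !mulN1r !opprK sqrtr1 expr1n mulr1 => t2.
  have : `|T e e e| <= K by rewrite ler_norml; lra.
  move=> t3; apply: le_trans (ler_norm _) _; rewrite normrM mulrC.
  by rewrite ler_wpM2r.
have [f [f1 wE]] := normalize w w0; set W := Num.sqrt (q w w) in wE.
have W0 : 0 < W.
  by rewrite sqrtr_gt0 lt_neqAle q_ge0 andbT eq_sym; apply: contraNneq w0 => /q_def ->.
have fe : q f e = 0.
  by move: we; rewrite wE !qE => /eqP; rewrite mulf_eq0 gt_eqF //= => /eqP.
have ef : q e f = 0 by rewrite qC.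
have cub : Num.sqrt (T e e e ^+ 2 + T f e e ^+ 2) <= K.
  apply: (@cubic_form_sqrt_le _ _ _ (T f f e) (T f f f)) => c s cs1.
  have := T_diag (c *: e + s *: f); rewrite !TE !qE fe ef e1 f1.
  rewrite (_ : c * (c * 1 + s * 0) + s * (c * 0 + s * 1) = 1); last by lra.
  rewrite sqrtr1 expr1n mulr1; apply: le_trans; rewrite le_eqVlt; apply/orP; left; apply/eqP.
  rewrite (T23 e e f) (T12 e f e) (T12 e f f) (T23 f e f). ring.
have hh : q h h = B ^+ 2 + W ^+ 2.
  by rewrite hE wE !qE fe ef e1 f1; ring.
have hT : T h e e = B * T e e e + W * T f e e by rewrite {1}hE wE !TE.
rewrite hT hh; apply: (@le_trans _ _
  (Num.sqrt (T e e e ^+ 2 + T f e e ^+ 2) * Num.sqrt (B ^+ 2 + W ^+ 2))); last first.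
  by rewrite ler_wpM2r // sqrtr_ge0.
rewrite -sqrtrM ?addr_ge0 ?sqr_ge0 //; apply: le_trans (ler_norm _) _.
rewrite -sqrtr_sqr ler_wsqrtr // -subr_ge0.
set t0 := T e e e; set t1 := T f e e.
have -> : (t0 ^+ 2 + t1 ^+ 2) * (B ^+ 2 + W ^+ 2) - (B * t0 + W * t1) ^+ 2 =
  (t0 * W - t1 * B) ^+ 2 by ring.
exact: sqr_ge0.
Qed.

End Forms.

(** * Spectral bounds for the coarse direction *)

Section DotProduct.
Context {R : realType}.

Lemma dotcDl n (u v w : 'cV[R]_n) : dotc (u + v) w = dotc u w + dotc v w.
Proof. by rewrite /dotc linearD /= mulmxDl mxE. Qed.

Lemma dotcZl n (a : R) (u w : 'cV[R]_n) : dotc (a *: u) w = a * dotc u w.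
Proof. by rewrite /dotc linearZ /= -scalemxAl mxE. Qed.

Lemma dotcC n (u v : 'cV[R]_n) : dotc u v = dotc v u.
Proof.
by rewrite /dotc !mxE; apply: eq_bigr => i _; rewrite !mxE mulrC.
Qed.

Lemma dotcDr n (u v w : 'cV[R]_n) : dotc w (u + v) = dotc w u + dotc w v.
Proof. by rewrite ![dotc w _]dotcC dotcDl. Qed.

Lemma dotcZr n (a : R) (u w : 'cV[R]_n) : dotc w (a *: u) = a * dotc w u.
Proof. by rewrite ![dotc w _]dotcC dotcZl. Qed.

Lemma dotcBr n (u v w : 'cV[R]_n) : dotc w (u - v) = dotc w u - dotc w v.
Proof. by rewrite dotcDr -scaleN1r dotcZr mulN1r. Qed.

Lemma dotc_mulmx m n (A : 'M[R]_(m, n)) u v : dotc u (A *m v) = dotc (A^T *m u) v.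
Proof. by rewrite /dotc trmx_mul trmxK mulmxA. Qed.

Lemma dotc_mulmxl m n (A : 'M[R]_(m, n)) u v : dotc (A *m u) v = dotc u (A^T *m v).
Proof. by rewrite dotcC dotc_mulmx dotcC. Qed.

Lemma dotc0r n (u : 'cV[R]_n) : dotc u 0 = 0.
Proof. by rewrite /dotc mulmx0 mxE. Qed.

Lemma dotc_sum n (u v : 'cV[R]_n) : dotc u v = \sum_i u i ord0 * v i ord0.
Proof. by rewrite /dotc mxE; apply: eq_bigr => i _; rewrite mxE. Qed.

Lemma dotc_ge0 n (u : 'cV[R]_n) : 0 <= dotc u u.
Proof. by rewrite dotc_sum sumr_ge0 // => i _; rewrite -expr2 sqr_ge0. Qed.

Lemma dotc_eq0 n (u : 'cV[R]_n) : dotc u u = 0 -> u = 0.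
Proof.
rewrite dotc_sum => /eqP; rewrite psumr_eq0 => [/allP u0|i _]; last by rewrite -expr2 sqr_ge0.
apply/matrixP => i j; rewrite mxE ord1.
by have := u0 i (mem_index_enum i); rewrite -expr2 sqrf_eq0 => /eqP.
Qed.

Lemma coord_sqr_le_dotc n (u : 'cV[R]_n) i : u i ord0 ^+ 2 <= dotc u u.
Proof.
rewrite dotc_sum (bigD1 i) //= -expr2 lerDl sumr_ge0 // => j _.
by rewrite -expr2 sqr_ge0.
Qed.

(** A crude constant, the sum of the absolute values of the entries, suffices. *)
Lemma quadratic_form_bounded n (B : 'M[R]_n) : exists2 K : R, 0 < K &
  forall v : 'cV[R]_n, `|dotc v (B *m v)| <= K * dotc v v.
Proof.
exists (1 + \sum_i \sum_j `|B i j|).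
  by rewrite ltr_pwDl // sumr_ge0 // => i _; rewrite sumr_ge0.
move=> v; have v0 := dotc_ge0 v; rewrite mulrDl mul1r; apply: ler_wpDl => //.
rewrite [in leLHS]dotc_sum mulr_suml; apply: le_trans (ler_norm_sum _ _ _) _.
apply: ler_sum => i _; rewrite mxE mulr_suml mulr_sumr.
apply: le_trans (ler_norm_sum _ _ _) _; apply: ler_sum => j _.
rewrite mulrCA normrM ler_wpM2l // ler_norml.
have := coord_sqr_le_dotc v i; have := coord_sqr_le_dotc v j.
by nra.
Qed.

Definition psd n (A : 'M[R]_n) := forall v, 0 <= dotc v (A *m v).

(** Cauchy-Schwarz for the form of A, applied to v and A^-1 v, gives
    (v.v)^2 <= (v.A v) (v.A^-1 v), and the last factor is at most K (v.v). *)
Lemma psd_unitmx_lower n (A : 'M[R]_n) : A^T = A -> psd A -> A \in unitmx ->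
  exists2 kappa : R, 0 < kappa & forall v, kappa * dotc v v <= dotc v (A *m v).
Proof.
move=> Asym Apsd Aunit; have [K K0 bK] := quadratic_form_bounded (invmx A).
exists K^-1 => [|v]; first by rewrite invr_gt0.
have form : semi_inner (fun u v => dotc u (A *m v)).
  split=> [a u w z|u w|u]; [by rewrite dotcDl dotcZl|by rewrite dotc_mulmx Asym dotcC|exact: Apsd].
have := semi_inner_cauchy_sqr form v (invmx A *m v).
rewrite mulmxA mulmxV // mul1mx => cs.
have [v0|v_gt0] := leP (dotc v v) 0.
  by apply: le_trans (Apsd v); rewrite mulr_ge0_le0 // invr_ge0 ltW.
have := bK v; rewrite [dotc (invmx A *m v) v]dotcC in cs.
rewrite ler_norml => /andP[_ up].
have := ler_wpM2l (Apsd v) up => /(le_trans cs).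
by rewrite mulrA expr2 ler_pM2r // ler_pdivrMl // mulrC.
Qed.

End DotProduct.

Section Deflation.
Variable K : comNzRingType.

(** Both sides are the determinant of the block matrix with rows (1, -A) and
    (B, 1), which has a factorization with each of the two complements. *)
Lemma det_1Dmulmx (m n : nat) (A : 'M[K]_(m, n)) (B : 'M[K]_(n, m)) :
  \det (1%:M + A *m B) = \det (1%:M + B *m A).
Proof.
have e1 : block_mx 1%:M (- A) B 1%:M =
    block_mx 1%:M 0 B 1%:M *m block_mx 1%:M (- A) 0 (1%:M + B *m A).
  by rewrite mulmx_block !(mul1mx, mulmx1, mul0mx, mulmx0, addr0) mulmxN addrCA addNr addr0.
have e2 : block_mx 1%:M (- A) B 1%:M =
    block_mx (1%:M + A *m B) (- A) 0 1%:M *m block_mx 1%:M 0 B 1%:M.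
  by rewrite mulmx_block !(mul1mx, mulmx1, mul0mx, mulmx0, add0r) mulNmx addrK.
have := congr1 (@determinant _ _) (etrans (esym e1) e2).
by rewrite !det_mulmx !det_lblock !det_ublock !det1 !mul1r !mulr1.
Qed.

Variables (m p : nat) (M : 'M[K]_m) (U : 'M[K]_(m, p)) (S : 'M[K]_p).

(** If the orthonormal columns of U span a subspace on which M acts as S, and M
    preserves its orthogonal, then this matrix is the identity on that subspace and x - M on
    its orthogonal. *)
Definition deflate (x : K) : 'M[K]_m := x%:M - M - U *m (x%:M - S - 1%:M) *m U^T.

(** x - M is the product of the deflated matrix with
    1 + U (x - S - 1) U^T, which is x - S on the span of U and the identity on
    its orthogonal. *)
Lemma det_deflate (x : K) : U^T *m U = 1%:M -> U^T *m M = S *m U^T ->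
  \det (x%:M - M) = \det (x%:M - S) * \det (deflate x).
Proof.
move=> UU UM; set B := x%:M - S; pose E := U *m (B - 1%:M) *m U^T.
have -> : \det B = \det (1%:M + E).
  by rewrite /E -mulmxA det_1Dmulmx -mulmxA UU mulmx1 addrC subrK.
rewrite -det_mulmx; congr (\det _).
rewrite /deflate -/B -/E mulmxDl mul1mx mulmxBr.
have -> : E *m (x%:M - M) = U *m (B - 1%:M) *m B *m U^T.
  rewrite /E -!mulmxA; do 2 congr (_ *m _).
  by rewrite mulmxBr UM /B mulmxBl scalar_mxC.
have -> : E *m E = U *m (B - 1%:M) *m (B - 1%:M) *m U^T.
  by rewrite /E -!mulmxA (mulmxA U^T U) UU mul1mx.
rewrite -mulmxBl -mulmxBr opprB addrCA subrr addr0 mulmx1 -/E.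
by rewrite subrK.
Qed.

End Deflation.

Section ReducedHessian.
Context {R : realType} {N p : nat}.
Variables (M : 'M[R]_N) (sigma : seq R) (U : 'M[R]_(N, p)).
Hypothesis p_lt_N : (p < N)%N.
Hypothesis M_sym : M^T = M.
Hypothesis M_eig : sorted_eigenvalues M sigma.
Hypothesis sigma_gt0 : forall i, (i < N)%N -> 0 < sigma`_i.
Hypothesis U_eig : top_eigenvectors M sigma U.

Let UU : U^T *m U = 1%:M. Proof. by case: U_eig. Qed.
Let MU : M *m U = U *m Sigma_top p sigma. Proof. by case: U_eig. Qed.

Lemma Sigma_top_sym : (Sigma_top p sigma)^T = Sigma_top p sigma.
Proof. exact: tr_diag_mx. Qed.

Let UM : U^T *m M = Sigma_top p sigma *m U^T.
Proof. by rewrite -[in LHS]M_sym -trmx_mul MU trmx_mul Sigma_top_sym. Qed.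

Lemma size_eigenvalues : size sigma = N.
Proof.
have [_ char] := M_eig; have := size_char_poly M.
by rewrite char size_prod_XsubC => -[].
Qed.

Lemma eigenvalue_le i j : (i <= j < N)%N -> sigma`_j <= sigma`_i.
Proof.
move=> /andP[ij jN]; have [srt _] := M_eig.
by apply: (sorted_leq_nth ge_trans ge_refl 0 srt) => //;
  rewrite ?inE ?size_eigenvalues ?(leq_ltn_trans ij).
Qed.

Local Notation toP A := (map_mx (@polyC R) A).

(** The factors of the p known eigenvalues can be cancelled only as polynomials,
    because c may be one of these eigenvalues; so [det_deflate] is used with the
    indeterminate in place of c, and evaluated afterwards. *)
Lemma det_deflate_eigenvalues (c : R) :
  \det (deflate M U (Sigma_top p sigma) c) = \prod_(a <- drop p sigma) (c - a).
Proof.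
have eP := @det_deflate _ _ _ (toP M) (toP U) (toP (Sigma_top p sigma)) 'X.
have UUP : (toP U)^T *m toP U = 1%:M.
  by rewrite map_trmx -map_mxM UU map_mx1.
have UMP : (toP U)^T *m toP M = toP (Sigma_top p sigma) *m (toP U)^T.
  by rewrite map_trmx -!map_mxM UM.
have {eP UUP UMP} := eP UUP UMP.
have -> : \det ('X%:M - toP M) = char_poly M by [].
have [_ ->] := M_eig.
have -> : \det ('X%:M - toP (Sigma_top p sigma)) = \prod_(i < p) ('X - (sigma`_i)%:P).
  rewrite (_ : 'X%:M - toP (Sigma_top p sigma) = diag_mx (\row_i ('X - (sigma`_i)%:P))).
    by rewrite det_diag; apply: eq_bigr => i _; rewrite mxE.
  apply/matrixP => i j; rewrite !mxE; case: (i == j); rewrite ?mulr1n ?mulr0n //.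
  by rewrite polyC0 subr0.
have -> : \prod_(a <- sigma) ('X - a%:P) =
   \prod_(i < p) ('X - (sigma`_i)%:P) * \prod_(a <- drop p sigma) ('X - a%:P).
  rewrite -{1}(cat_take_drop p sigma) big_cat /=; congr (_ * _).
  rewrite (big_nth 0) size_take size_eigenvalues p_lt_N big_mkord.
  by apply: eq_bigr => i _; rewrite nth_take.
move/mulfI => H; have {H} := H _.
have nz : \prod_(i < p) ('X - (sigma`_i)%:P) != 0.
  by rewrite prodf_seq_neq0; apply/allP => i _; rewrite polyXsubC_eq0.
move=> /(_ nz) /(congr1 (horner_eval c)) /esym; rewrite /horner_eval horner_prod.
rewrite -[X in X = _ -> _]/(horner_eval c _) -det_map_mx => H.
rewrite (_ : deflate _ _ _ _ = map_mx (horner_eval c)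
  (deflate (toP M) (toP U) (toP (Sigma_top p sigma)) 'X)).
  by rewrite H; apply: eq_bigr => a _; rewrite hornerXsubC.
have back k l (A : 'M[R]_(k, l)) : map_mx (horner_eval c) (toP A) = A.
  by apply/matrixP => i j; rewrite !mxE /horner_eval hornerC.
have backX k : map_mx (horner_eval c) ('X%:M : 'M[{poly R}]_k) = c%:M.
  by rewrite map_scalar_mx /= /horner_eval hornerX.
by rewrite /deflate map_trmx !(map_mxB, map_mxM) /= !back !backX map_mx1.
Qed.

Lemma dotc_deflate (c : R) v : let a := U^T *m v in
  dotc v (deflate M U (Sigma_top p sigma) c *m v) =
  c * dotc v v - dotc v (M *m v)
  - (c * dotc a a - dotc a (Sigma_top p sigma *m a) - dotc a a).
Proof.
move=> a; rewrite /deflate !mulmxBl mul_scalar_mx !dotcBr dotcZr -!mulmxA.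
rewrite [dotc v (U *m _)]dotc_mulmx.
by rewrite !mulmxBl !mul_scalar_mx scale1r !dotcBr dotcZr.
Qed.

Lemma deflate_sym (c : R) :
  (deflate M U (Sigma_top p sigma) c)^T = deflate M U (Sigma_top p sigma) c.
Proof.
rewrite /deflate; set X := c%:M - _ - 1%:M.
have XT : X^T = X by rewrite /X !linearB /= !tr_scalar_mx Sigma_top_sym.
by move: X XT => X XT; rewrite !linearB /= tr_scalar_mx M_sym !trmx_mul trmxK XT mulmxA.
Qed.

Definition complement (v : 'cV[R]_N) := v - U *m (U^T *m v).

Lemma complement_orth v : U^T *m complement v = 0.
Proof. by rewrite /complement mulmxBr !mulmxA UU mul1mx subrr. Qed.

Lemma complementE v : v = U *m (U^T *m v) + complement v.
Proof. by rewrite /complement addrC subrK. Qed.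

Lemma dotc_complement v :
  dotc v v = dotc (U^T *m v) (U^T *m v) + dotc (complement v) (complement v).
Proof.
move: (complement_orth v) (complementE v).
move: (complement v) (U^T *m v) => z a oz e.
rewrite {1 2}e dotcDl !dotcDr [dotc z (U *m a)]dotcC !dotc_mulmxl.
by rewrite (mulmxA U^T U) UU mul1mx oz dotc0r addr0 add0r.
Qed.

Lemma dotc_mul_complement v : dotc v (M *m v) =
  dotc (U^T *m v) (Sigma_top p sigma *m (U^T *m v))
  + dotc (complement v) (M *m complement v).
Proof.
move: (complement_orth v) (complementE v).
move: (complement v) (U^T *m v) => z a oz e.
have cross : U^T *m (M *m z) = 0 by rewrite mulmxA UM -mulmxA oz mulmx0.
rewrite {1 2}e mulmxDr mulmxA MU -mulmxA dotcDl !dotcDr.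
rewrite [dotc z (U *m _)]dotcC !dotc_mulmxl cross oz (mulmxA U^T U) UU mul1mx.
by rewrite ?mulmx0 !dotc0r addr0 add0r.
Qed.

(** Let m be the least c for which the deflated matrix is positive semidefinite.
    If the bound failed at z, then m > sigma`_p, so c = m is none of the remaining
    eigenvalues and the deflated matrix is invertible at m.  Being semidefinite,
    it is then bounded below by some kappa > 0, and m - kappa would still do. *)
Lemma rayleigh_complement_le z : U^T *m z = 0 -> dotc z (M *m z) <= sigma`_p * dotc z z.
Proof.
move=> Uz; rewrite leNgt; apply/negP => gt.
set A := deflate M U (Sigma_top p sigma).
have [z0|z0] := leP (dotc z z) 0.
  have /dotc_eq0 zE : dotc z z = 0 by apply/eqP; rewrite eq_le z0 dotc_ge0.
  by move: gt; rewrite zE mulmx0 !dotc0r mulr0 ltxx.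
have proj v : dotc (U^T *m v) (U^T *m v) <= dotc v v.
  by rewrite (dotc_complement v) lerDl dotc_ge0.
have formA c c' v : dotc v (A c' *m v) =
    dotc v (A c *m v) + (c' - c) * (dotc v v - dotc (U^T *m v) (U^T *m v)).
  by rewrite /A !dotc_deflate; ring.
have mono c c' : c <= c' -> psd (A c) -> psd (A c').
  move=> cc' Ac v; rewrite (formA c) addr_ge0 //.
  by rewrite mulr_ge0 ?subr_ge0.
pose E := [set c | psd (A c)].
have E_lb c : E c -> dotc z (M *m z) / dotc z z <= c.
  move=> /(_ z); rewrite /A dotc_deflate Uz mulmx0 !dotc0r mulr0 !subr0 subr_ge0.
  by rewrite ler_pdivrMr.
have [K K0 bK] := quadratic_form_bounded M.
(* on the orthogonal of U, K dominates M *)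
have E_ex : E K.
  move=> v; rewrite /A dotc_deflate dotc_mul_complement (dotc_complement v).
  have := bK (complement v); rewrite ler_norml => /andP[_].
  by have := dotc_ge0 (U^T *m v); lra.
have E_inf : has_inf E by split; [exists K | exists (dotc z (M *m z) / dotc z z) => c; exact: E_lb].
pose m := inf E.
have m_gt : sigma`_p < m.
  apply: lt_le_trans (_ : _ < dotc z (M *m z) / dotc z z) _; first by rewrite ltr_pdivlMr.
  by apply: lb_le_inf; [case: E_inf | move=> c; exact: E_lb].
have Am : psd (A m).
  move=> v; rewrite leNgt; apply/negP => neg.
  have vv : 0 < dotc v v.
    rewrite lt_neqAle dotc_ge0 andbT eq_sym; apply/eqP => /dotc_eq0 v0.
    by move: neg; rewrite v0 mulmx0 dotc0r ltxx.
  have e0 : 0 < - dotc v (A m *m v) / dotc v v by rewrite divr_gt0 // oppr_gt0.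
  have [c Ec cm] := inf_adherent e0 E_inf.
  have := Ec v; rewrite (formA m); apply/negP; rewrite -ltNge.
  have cm0 : 0 <= c - m by rewrite subr_ge0; apply: ge_inf => //; case: E_inf.
  have : (c - m) * (dotc v v - dotc (U^T *m v) (U^T *m v)) <= (c - m) * dotc v v.
    by rewrite ler_wpM2l // gerBl dotc_ge0.
  have : (c - m) * dotc v v < - dotc v (A m *m v).
    by rewrite -ltr_pdivlMr // ltrBlDl.
  by lra.
have Aunit : A m \in unitmx.
  rewrite unitmxE unitfE det_deflate_eigenvalues prodf_seq_neq0; apply/allP => a.
  move=> /(nthP 0)[i]; rewrite size_drop size_eigenvalues nth_drop => iN <-.
  rewrite subr_eq0 gt_eqF //; apply: le_lt_trans m_gt.
  by apply: eigenvalue_le; rewrite leq_addr /= -ltn_subRL.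
have [kappa k0 Ak] := psd_unitmx_lower (deflate_sym m) Am Aunit.
have : E (m - kappa).
  move=> v; rewrite (formA m); have := Ak v; have := dotc_ge0 (U^T *m v).
  by rewrite -/A; nra.
move=> /(ge_inf (proj2 E_inf)); rewrite -/m; lra.
Qed.

Lemma Sigma_top_unitmx : Sigma_top p sigma \in unitmx.
Proof.
rewrite unitmxE unitfE det_diag; apply/prodf_neq0 => i _.
by rewrite mxE gt_eqF // sigma_gt0 // (ltn_trans (ltn_ord i)).
Qed.

Lemma QH_invE y : QH_inv sigma U *m y =
  U *m (invmx (Sigma_top p sigma) *m (U^T *m y)) + (sigma`_p)^-1 *: complement y.
Proof.
rewrite /QH_inv /complement mulmxDl mulmxBr !mulmxBl mul_mx_scalar -!scalemxAl.
by rewrite mul_scalar_mx -!mulmxA scalerBr addrCA addrA.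
Qed.

(** On the span of U both sides agree; on its orthogonal they compare
    M / sigma`_p^2 with 1 / sigma`_p, which is [rayleigh_complement_le]. *)
Lemma QH_inv_energy_le y :
  dotc (QH_inv sigma U *m y) (M *m (QH_inv sigma U *m y)) <= dotc y (QH_inv sigma U *m y).
Proof.
set v := QH_inv sigma U *m y.
have Uv : U^T *m v = invmx (Sigma_top p sigma) *m (U^T *m y).
  by rewrite /v QH_invE mulmxDr -scalemxAr complement_orth scaler0 addr0 (mulmxA U^T U) UU mul1mx.
have cv : complement v = (sigma`_p)^-1 *: complement y.
  by rewrite {1}/complement Uv {1}/v QH_invE addrC addrA addNr add0r.
have -> : dotc y v = dotc (U^T *m y) (invmx (Sigma_top p sigma) *m (U^T *m y))
    + (sigma`_p)^-1 * dotc (complement y) (complement y).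
  rewrite /v QH_invE dotcDr dotc_mulmx dotcZr; congr (_ + _ * _).
  by rewrite {1}(complementE y) dotcDl dotc_mulmxl complement_orth dotc0r add0r.
rewrite dotc_mul_complement Uv cv (mulmxA (Sigma_top p sigma)) mulmxV ?Sigma_top_unitmx // mul1mx.
rewrite [dotc (invmx _ *m _) _]dotcC lerD2l -scalemxAr dotcZl dotcZr.
have sp : 0 < sigma`_p by apply: sigma_gt0.
rewrite ler_wpM2l ?invr_ge0 ?(ltW sp) // ler_pdivrMl //.
by apply: rayleigh_complement_le; exact: complement_orth.
Qed.

Lemma eigenvalue_ratio_gt0 : 0 < eigenvalue_ratio (N := N) p sigma.
Proof.
by rewrite divr_gt0 // sigma_gt0 // prednK // (leq_ltn_trans _ p_lt_N).
Qed.

Lemma eigenvalue_ratio_le1 : eigenvalue_ratio (N := N) p sigma <= 1.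
Proof.
have N0 : (0 < N)%N by rewrite (leq_ltn_trans _ p_lt_N).
rewrite ler_pdivrMr ?sigma_gt0 // mul1r; apply: eigenvalue_le.
by rewrite -ltnS !prednK // p_lt_N leqnn.
Qed.

End ReducedHessian.

Section CoarseStep.
Context {R : realType} {n N p : nat}.
Variables (f : 'cV[R]_n -> R) (x : 'cV[R]_n) (s : 'I_N -> 'I_n).
Variables (sigma : seq R) (U : 'M[R]_(N, p)).
Hypothesis p_lt_N : (p < N)%N.
Hypothesis hess_sym : (hessian f x)^T = hessian f x.
Hypothesis sigma_eig : sorted_eigenvalues (reduced_hessian f x s) sigma.
Hypothesis sigma_gt0 : forall i, (i < N)%N -> 0 < sigma`_i.
Hypothesis U_eig : top_eigenvectors (reduced_hessian f x s) sigma U.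

Lemma reduced_hessian_sym : (reduced_hessian f x s)^T = reduced_hessian f x s.
Proof. by rewrite /reduced_hessian /restriction !trmx_mul trmxK hess_sym mulmxA. Qed.

Lemma Qh_inv_energy_le g :
  dotc (Qh_inv s sigma U *m g) (hessian f x *m (Qh_inv s sigma U *m g))
  <= dotc g (Qh_inv s sigma U *m g).
Proof.
have := QH_inv_energy_le p_lt_N reduced_hessian_sym sigma_eig sigma_gt0 U_eig (restriction s *m g).
rewrite /Qh_inv -!mulmxA; set w := QH_inv sigma U *m _.
by rewrite /reduced_hessian !dotc_mulmxl !dotc_mulmx /restriction trmxK !mulmxA.
Qed.

End CoarseStep.

(** * Self-concordant functions *)

Section Lines.
Context {R : realType} {n : nat}.
Implicit Types (D : set 'cV[R]_n) (f g : 'cV[R]_n -> R) (x y u v w d : 'cV[R]_n).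

Lemma near_line D x u (t : R) : open D -> D (x + t *: u) ->
  \forall s \near t, D (x + s *: u).
Proof.
move=> Do Dt.
have : (fun s : R => x + s *: u) @ t --> x + t *: u.
  by apply: cvgD; [exact: cvg_cst | exact: scalel_continuous].
by apply; exact: open_nbhs_nbhs.
Qed.

Lemma convex_line D x d (s t : R) :
  convex_set (D : set (convex_lmodType 'cV[R]_n)) ->
  D x -> D (x + t *: d) -> 0 <= s <= t -> D (x + s *: d).
Proof.
move=> Dc Dx Dt /andP[s0 st].
have [t0|t0] := eqVneq t 0.
  suff -> : s = 0 by rewrite scale0r addr0.
  by apply/eqP; rewrite eq_le s0 -t0 st.
have t_gt0 : 0 < t by rewrite lt_neqAle eq_sym t0 (le_trans s0).
have l0 : 0 <= s / t by rewrite divr_ge0 // ltW.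
have l1 : s / t <= 1 by rewrite ler_pdivrMr // mul1r.
have xD : x \in D by rewrite inE.
have tD : x + t *: d \in D by rewrite inE.
have := Dc _ _ (Itv01 l0 l1) tD xD; rewrite inE /conv /=.
by by rewrite scalerDr scalerA divfK // addrAC -scalerDl addrC unstable.add_onemK scale1r addrC.
Qed.

Lemma is_derive_dirder_line D g x u (t : R) : open D -> C_on 1 D g ->
  D (x + t *: u) ->
  is_derive t 1 (fun t : R => g (x + t *: u)) (dirder u g (x + t *: u)).
Proof. by move=> Do g1 Dt; apply/is_derive_line/(is_derive_dirder _ Do g1 Dt). Qed.

Lemma derive1_line D g (psi : R -> R) x u (t : R) : open D -> C_on 1 D g ->
  (forall s : R, D (x + s *: u) -> psi s = g (x + s *: u)) -> D (x + t *: u) ->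
  derive1 psi t = dirder u g (x + t *: u).
Proof.
move=> Do g1 psiE Dt.
have [_ <-] := is_derive_dirder_line Do g1 Dt.
rewrite derive1E; apply: near_eq_derive.
by apply: filterS (near_line Do Dt) => s; exact: psiE.
Qed.

Lemma derive1n2_line D f x u (t : R) : open D -> C_on 2 D f -> D (x + t *: u) ->
  derive1n 2 (fun t : R => f (x + t *: u)) t = dirder u (dirder u f) (x + t *: u).
Proof.
move=> Do f2; rewrite derive1nS; apply: derive1_line => //; first exact: C_on_dirder.
move=> s Ds; rewrite derive1n1; apply: (derive1_line (g := f) Do) => //.
exact: C_onW f2.
Qed.

Lemma derive1n3_line D f x u (t : R) : open D -> C_on 3 D f -> D (x + t *: u) ->
  derive1n 3 (fun t : R => f (x + t *: u)) t =
  dirder u (dirder u (dirder u f)) (x + t *: u).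
Proof.
move=> Do f3; rewrite derive1nS; apply: derive1_line => //.
  by apply: C_on_dirder => //; apply: C_on_dirder.
by move=> s; apply: derive1n2_line => //; exact: C_onW.
Qed.

End Lines.

Section SelfConcordant.
Context {R : realType} {n : nat} (D : set 'cV[R]_n) (f : 'cV[R]_n -> R).
Hypothesis D_open : open D.
Hypothesis f_C3 : C_on 3 D f.
Hypothesis f_strict : strictly_convex_on D f.
Hypothesis f_sc : self_concordant_on D f.
Implicit Types (x y u v w d : 'cV[R]_n).

Definition hess_form y u v := dirder u (dirder v f) y.

Definition third_form y u v w := dirder u (dirder v (dirder w f)) y.

Let f_C2 : C_on 2 D f := C_onW f_C3.
Let f_C1 : C_on 1 D f := C_onW f_C2.
Let df_C2 v : C_on 2 D (dirder v f) := C_on_dirder v D_open f_C3.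
Let df_C1 v : C_on 1 D (dirder v f) := C_onW (df_C2 v).
Let ddf_C1 u v : C_on 1 D (dirder u (dirder v f)) := C_on_dirder u D_open (df_C2 v).

Lemma hess_formC y u v : D y -> hess_form y u v = hess_form y v u.
Proof. by move=> Dy; exact: dirderC D_open f_C2 Dy. Qed.

Lemma third_form12 y u v w : D y -> third_form y u v w = third_form y v u w.
Proof. by move=> Dy; exact: dirderC D_open (df_C2 w) Dy. Qed.

Lemma third_form23 y u v w : D y -> third_form y u v w = third_form y u w v.
Proof. by move=> Dy; apply: eq_on_dirder D_open _ Dy => z; exact: hess_formC. Qed.

Lemma is_derive_f_line x d t : D (x + t *: d) ->
  is_derive t 1 (fun t : R => f (x + t *: d)) (dirder d f (x + t *: d)).
Proof. exact: is_derive_dirder_line D_open f_C1. Qed.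

Lemma is_derive_dirder_f_line x d v t : D (x + t *: d) ->
  is_derive t 1 (fun t : R => dirder v f (x + t *: d)) (hess_form (x + t *: d) d v).
Proof. exact: is_derive_dirder_line D_open (df_C1 v). Qed.

Lemma is_derive_hess_form_line x d u v t : D (x + t *: d) ->
  is_derive t 1 (fun t : R => hess_form (x + t *: d) u v) (third_form (x + t *: d) d u v).
Proof. exact: is_derive_dirder_line D_open (ddf_C1 u v). Qed.

Lemma line_radius x d : D x -> exists2 e : R, 0 < e &
  forall t, `|t| <= e -> D (x + t *: d).
Proof.
move=> Dx; have : D (x + 0 *: d) by rewrite scale0r addr0.
move=> /(near_line D_open)/nbhs_ballP[e /= e0 H].
exists (e / 2) => [|t te]; first by rewrite divr_gt0.
apply: H; rewrite -ball_normE /= sub0r normrN; apply: le_lt_trans te _.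
by rewrite ltr_pdivrMr // ltr_pMr // ltr1n.
Qed.

Lemma midpoint_lt x d : D x -> D (x + d) -> D (x - d) -> d != 0 ->
  2 * f x < f (x + d) + f (x - d).
Proof.
move=> Dx Dp Dm d0.
have := @f_strict (x + d) (x - d) (1 / 2) Dp Dm.
rewrite (_ : (1 / 2) *: (x + d) + (1 - 1 / 2) *: (x - d) = x); last first.
  rewrite (_ : 1 - 1 / 2 = 1 / 2 :> R); last by field.
  rewrite -scalerDr addrACA subrr addr0 scalerDr -scalerDl.
  by rewrite (_ : 1 / 2 + 1 / 2 = 1 :> R) ?scale1r //; field.
have -> : x + d != x - d.
  rewrite -subr_eq0 opprD opprK addrACA subrr add0r -mulr2n -scaler_nat scaler_eq0.
  by rewrite pnatr_eq0.
move=> /(_ isT); have -> : 0 < (1 / 2 : R) < 1 by apply/andP; split; lra.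
by move=> /(_ isT); lra.
Qed.

Lemma dirder0 g y : dirder 0 g y = 0.
Proof. by have := dirderDZ 0 0 1 g y; rewrite scaler0 addr0; lra. Qed.

Lemma dirderN v g y : dirder (- v) g y = - dirder v g y.
Proof.
by have := dirderDZ v 0 (-1) g y; rewrite addr0 scaleN1r dirder0 addr0 mulN1r.
Qed.

Lemma hess_formNN y v : D y -> hess_form y (- v) (- v) = hess_form y v v.
Proof.
move=> Dy; rewrite /hess_form dirderN -/(hess_form y v (- v)) hess_formC //.
by rewrite /hess_form dirderN opprK.
Qed.

(** Otherwise f would lie below its tangent at y on both sides of y, against
    strict convexity at the midpoint. *)
Lemma curvature_gt0 y v (T : R) : D y -> v != 0 -> 0 < T ->
  (forall t, `|t| <= T -> D (y + t *: v)) ->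
  exists2 t, `|t| <= T & 0 < hess_form (y + t *: v) v v.
Proof.
move=> Dy v0 T0 inD; apply: contrapT => no_curv.
have neg t : `|t| <= T -> hess_form (y + t *: v) v v <= 0.
  by move=> tT; rewrite leNgt; apply/negP => ?; apply: no_curv; exists t.
have key u : u = v \/ u = - v -> f (y + T *: u) <= f y + T * dirder u f y.
  move=> uv; have inDu t : 0 <= t <= T -> D (y + t *: u).
    move=> /andP[t0 tT]; case: uv => ->; first by apply: inD; rewrite ger0_norm.
    by rewrite scalerN -scaleNr; apply: inD; rewrite normrN ger0_norm.
  have := @le0_derive2_le R (fun t => f (y + t *: u)) (fun t => dirder u f (y + t *: u))
    (fun t => hess_form (y + t *: u) u u) T (ltW T0).
  rewrite !scale0r !addr0; apply.
  - by move=> t /inDu; exact: is_derive_f_line.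
  - by move=> t /inDu; exact: is_derive_dirder_f_line.
  - move=> t tT; have Dt := inDu _ tT; move: tT => /andP[t0 tT].
    case: uv => uE; rewrite uE in Dt *; first by apply: neg; rewrite ger0_norm.
    by rewrite hess_formNN // scalerN -scaleNr; apply: neg; rewrite normrN ger0_norm.
have Tv0 : T *: v != 0 by rewrite scaler_eq0 negb_or v0 gt_eqF.
have TT : `|T| <= T by rewrite gtr0_norm.
have := key v (or_introl erefl); have := key (- v) (or_intror erefl).
rewrite dirderN scalerN => k1 k2.
have := midpoint_lt Dy (inD T TT) _ Tv0.
rewrite -scaleNr => m; have {m} := m (inD (- T) _); rewrite normrN scaleNr => /(_ TT).
by move: k1 k2; lra.
Qed.

Lemma hess_form_ge0 y v : D y -> 0 <= hess_form y v v.
Proof.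
move=> Dy; rewrite leNgt; apply/negP => h0.
have v0 : v != 0.
  by apply: contraTneq h0 => ->; rewrite -leNgt /hess_form dirder0.
have [e e0 eD] := line_radius v Dy.
have : \forall t \near (0 : R), hess_form (y + t *: v) v v < 0.
  have D0 : D (y + 0 *: v) by rewrite scale0r addr0.
  have [dd _] := is_derive_hess_form_line v v D0.
  have cc : {for (0 : R), continuous (fun t : R => hess_form (y + t *: v) v v)}.
    by apply/differentiable_continuous/derivable1_diffP.
  move: cc; rewrite /prop_for /continuous_at scale0r addr0 => cc.
  exact: (cvgr_lt _ cc).
move=> /nbhs_ballP[e' /= e'0 H].
pose T := Num.min e (e' / 2).
have T0 : 0 < T by rewrite lt_min e0 divr_gt0.
have inD t : `|t| <= T -> D (y + t *: v) by rewrite le_min => /andP[? _]; exact: eD.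
have [t tT] := curvature_gt0 Dy v0 T0 inD; apply/negP; rewrite -leNgt.
move: tT; rewrite le_min => /andP[_ te]; apply/ltW/H; rewrite -ball_normE /= sub0r normrN.
by apply: le_lt_trans te _; rewrite ltr_pdivrMr // ltr_pMr // ltr1n.
Qed.

Lemma hess_semi_inner y : D y -> semi_inner (hess_form y).
Proof.
move=> Dy; split=> [a u v w|u v|u].
- exact: dirderDZ.
- exact: hess_formC.
- exact: hess_form_ge0.
Qed.

Lemma powR_three_halves (a : R) : 0 <= a -> a `^ (3 / 2) = Num.sqrt a ^+ 3.
Proof.
move=> a0; rewrite -powR12_sqrt // -powR_mulrn ?powR_ge0 // -powRrM.
by congr (_ `^ _); field.
Qed.

(** The self-concordance hypothesis at t = 0. *)
Lemma third_form_diag y u : D y ->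
  `|third_form y u u u| <= 2 * Num.sqrt (hess_form y u u) ^+ 3.
Proof.
move=> Dy; have D0 : D (y + 0 *: u) by rewrite scale0r addr0.
have := f_sc Dy D0; rewrite (derive1n3_line D_open f_C3 D0) (derive1n2_line D_open f_C2 D0).
by rewrite scale0r addr0 powR_three_halves //; exact: hess_form_ge0.
Qed.

(** The radius r may exceed the local norm of d, so that the curvature along d is
    allowed to vanish.  This is what the proof of definiteness needs.  The
    differential inequality is applied to the curvature plus r^2 - |d|^2. *)
Lemma local_norm_growth x d (r T : R) : 0 <= T -> 0 < r ->
  hess_form x d d <= r ^+ 2 ->
  (forall t, 0 <= t <= T -> D (x + t *: d)) ->
  (hess_form x d d < r ^+ 2 \/
    forall t, 0 <= t <= T -> 0 < hess_form (x + t *: d) d d) ->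
  T * r < 1 ->
  hess_form (x + T *: d) d d <= (r / (1 - T * r)) ^+ 2.
Proof.
move=> T0 r0 xr inD pos Tr.
pose e := r ^+ 2 - hess_form x d d.
have e0 : 0 <= e by rewrite subr_ge0.
suff : hess_form (x + T *: d) d d + e <= (r / (1 - T * r)) ^+ 2 by lra.
apply: (@curvature_growth R (fun t => hess_form (x + t *: d) d d + e)
  (fun t => third_form (x + t *: d) d d d) r T T0 r0 _ _ _ _ Tr).
- have -> : 0 *: d = 0 by exact: scale0r.
  by rewrite (addr0 x) /e addrC subrK.
- move=> t tT; exact: is_derive_addcst (is_derive_hess_form_line d d (inD _ tT)).
- move=> t tT; have h0 := hess_form_ge0 d (inD _ tT).
  case: pos => [lt|/(_ t tT) gt]; first by apply: ltr_wpDl => //; rewrite subr_gt0.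
  exact: ltr_wpDr.
move=> t tT; have Dt := inD _ tT.
apply: le_trans (ler_norm _) _; apply: le_trans (third_form_diag _ Dt) _.
by rewrite ler_wpM2l // lerXn2r ?nnegrE ?sqrtr_ge0 // ler_wsqrtr // lerDl.
Qed.

(** [local_norm_growth] holds for every positive radius, however small. *)
Lemma hess_form_null_line y u s : D y -> hess_form y u u = 0 -> 0 <= s ->
  (forall t, 0 <= t <= s -> D (y + t *: u)) -> hess_form (y + s *: u) u u <= 0.
Proof.
move=> Dy hu s0 inDu.
have small z : 0 < z -> s * z <= 1 / 2 -> hess_form (y + s *: u) u u <= (2 * z) ^+ 2.
  move=> z0 sz; have sz1 : s * z < 1 by lra.
  have hz : hess_form y u u < z ^+ 2 by rewrite hu exprn_gt0.
  apply: le_trans (local_norm_growth s0 z0 (ltW hz) inDu (or_introl hz) sz1) _.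
  rewrite lerXn2r ?nnegrE ?divr_ge0 ?mulr_ge0 ?(ltW z0) ?subr_ge0 ?(ltW sz1) //.
  by rewrite ler_pdivrMr ?subr_gt0 //; nra.
rewrite leNgt; apply/negP; move: (hess_form _ u u) small => p small p0.
have sp0 : 0 < Num.sqrt p by rewrite sqrtr_gt0.
(* the first bound keeps s z <= 1/2, the second makes (2 z)^2 <= p / 4 *)
pose z := Num.min (2 * (s + 1))^-1 (Num.sqrt p / 4).
have s1 : 0 < 2 * (s + 1) by lra.
have z0 : 0 < z by rewrite lt_min invr_gt0 s1 divr_gt0.
have z1 : z * (2 * (s + 1)) <= 1.
  by rewrite -ler_pdivlMr // mul1r ge_min lexx.
have z4 : z <= Num.sqrt p / 4 by rewrite ge_min lexx orbT.
have : p <= (2 * z) ^+ 2 by apply: small => //; nra.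
have : (2 * z) ^+ 2 <= (Num.sqrt p / 2) ^+ 2.
  by rewrite lerXn2r ?nnegrE ?mulr_ge0 ?divr_ge0 ?(ltW z0) ?(ltW sp0) //; lra.
by rewrite expr_div_n sqr_sqrtr ?(ltW p0) //; lra.
Qed.

(** A null vector would be null along a whole segment, on which f would be
    affine. *)
Lemma hess_form_def y v : D y -> hess_form y v v = 0 -> v = 0.
Proof.
move=> Dy h0; apply/eqP/negPn/negP => v0.
have [T T0 inD] := line_radius v Dy.
have [t tT] := curvature_gt0 Dy v0 T0 inD; apply/negP; rewrite -leNgt.
have [t0|t0] := leP 0 t.
  apply: hess_form_null_line => // t' /andP[t'0 t't]; apply: inD.
  by rewrite ger0_norm // (le_trans t't) // (le_trans (ler_norm _)).
have Dt := inD _ tT; rewrite -hess_formNN //.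
have -> : t *: v = (- t) *: (- v) by rewrite scalerN scaleNr opprK.
apply: hess_form_null_line => //; first by rewrite hess_formNN.
  by rewrite oppr_ge0 ltW.
move=> t' /andP[t'0 t't]; rewrite scalerN -scaleNr; apply: inD.
by rewrite normrN ger0_norm // (le_trans t't) // -(ltr0_norm t0).
Qed.

Lemma third_form_linear a u v w z y :
  third_form y (a *: u + v) w z = a * third_form y u w z + third_form y v w z.
Proof. exact: dirderDZ. Qed.

Lemma third_form_mixed y h v : D y ->
  `|third_form y h v v| <= 2 * Num.sqrt (hess_form y h h) * hess_form y v v.
Proof.
move=> Dy.
have bound g : third_form y g v v <= 2 * Num.sqrt (hess_form y g g) * hess_form y v v.
  apply: (@trilinear_bound R _ (hess_form y) (third_form y) 2).
  - exact: hess_semi_inner.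
  - by move=> u; exact: hess_form_def.
  - by move=> a u w z z'; exact: third_form_linear.
  - by move=> u w z; exact: third_form12.
  - by move=> u w z; exact: third_form23.
  - by move=> u; apply: le_trans (third_form_diag u Dy); exact: ler_norm.
rewrite ler_norml bound andbT lerNl.
have := bound (- h); rewrite hess_formNN //.
by have := dirderN h (dirder v (dirder v f)) y; rewrite /third_form => ->.
Qed.

Section Segment.
Variables (x d : 'cV[R]_n) (r : R).
Hypothesis r_ge0 : 0 <= r.
Hypothesis r_norm : hess_form x d d = r ^+ 2.

Lemma hess_form_dir_le T : 0 <= T -> T * r < 1 ->
  (forall t, 0 <= t <= T -> D (x + t *: d)) ->
  hess_form (x + T *: d) d d <= (r / (1 - T * r)) ^+ 2.
Proof.
move=> T0 Tr inD.
have Dx : D x by have := inD 0; rewrite scale0r addr0; apply; rewrite lexx.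
have [r0|r_neq0] := eqVneq r 0.
  rewrite r0 mul0r expr0n /=.
  have -> : d = 0 by apply: hess_form_def Dx _; rewrite r_norm r0 expr0n.
  by rewrite /hess_form dirder0.
have r_gt0 : 0 < r by rewrite lt_neqAle eq_sym r_neq0.
apply: local_norm_growth => //; first by rewrite r_norm.
right=> t tT; rewrite lt_neqAle (hess_form_ge0 d (inD _ tT)) andbT eq_sym.
apply/eqP => /(hess_form_def (inD _ tT)) d0.
by move: r_norm; rewrite d0 /hess_form dirder0 => /esym/eqP; rewrite sqrf_eq0 (negPf r_neq0).
Qed.

(** With r the local norm of d at x, [hess_form_dir_le] bounds it at x + t d by
    r / (1 - t r); the mixed bound then makes the logarithmic derivative of
    |v|^2 at most 2 r / (1 - t r) in absolute value, that is, the one of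
    (1 - t r)^-2. *)
Lemma third_form_segment_le T v : 0 <= T -> T * r < 1 ->
  (forall t, 0 <= t <= T -> D (x + t *: d)) ->
  `|third_form (x + T *: d) d v v| <= 2 * (r / (1 - T * r)) * hess_form (x + T *: d) v v.
Proof.
move=> T0 Tr inD; have DT : D (x + T *: d) by apply: inD; rewrite T0 lexx.
apply: le_trans (third_form_mixed _ _ DT) _.
rewrite ler_wpM2r ?hess_form_ge0 // ler_wpM2l //.
have rr : 0 <= r / (1 - T * r) by rewrite divr_ge0 // subr_ge0 ltW.
by rewrite -(ger0_norm rr) -sqrtr_sqr ler_wsqrtr // hess_form_dir_le.
Qed.

Lemma hess_form_segment_ge T v : 0 <= T -> T * r < 1 ->
  (forall t, 0 <= t <= T -> D (x + t *: d)) ->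
  (1 - T * r) ^+ 2 * hess_form x v v <= hess_form (x + T *: d) v v.
Proof.
move=> T0 Tr inD.
have tr t : 0 <= t <= T -> t * r < 1.
  by move=> /andP[_ tT]; apply: le_lt_trans Tr; rewrite ler_wpM2r.
pose F t := - ((1 - t * r)^-1 * (1 - t * r)^-1 * hess_form (x + t *: d) v v).
have FT : F T <= F 0.
  apply: (@le0_derive_le R F (fun t =>
    - (((1 - t * r)^-1 * (1 - t * r)^-1) * third_form (x + t *: d) d v v
      + hess_form (x + t *: d) v v *
        ((1 - t * r)^-1 * (r * (1 - t * r) ^- 2)
         + (1 - t * r)^-1 * (r * (1 - t * r) ^- 2))))) => [//|t tT|t tT].
    have nz : 1 - t * r != 0 by rewrite subr_eq0 gt_eqF // tr.
    have di := is_derive_1Bmul_inv nz.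
    exact: is_deriveN (is_deriveM (is_deriveM di di) (is_derive_hess_form_line v v (inD _ tT))).
  have := @third_form_segment_le t v; case/andP: (tT) => t0 tT' /(_ t0 (tr _ tT)).
  move=> /(_ _)/wrap[]; first by move=> s /andP[s0 st]; apply: inD; rewrite s0 (le_trans st).
  rewrite ler_norml => /andP[+ _].
  have u0 : 0 < (1 - t * r)^-1 by rewrite invr_gt0 subr_gt0 tr.
  rewrite -exprVn; move: (1 - t * r)^-1 u0 (third_form _ _ _ _) (hess_form _ _ _) => u u0 th h H.
  rewrite oppr_le0.
  have -> : u * u * th + h * (u * (r * u ^+ 2) + u * (r * u ^+ 2)) =
    u ^+ 2 * (th + 2 * (r * u) * h) by ring.
  by rewrite mulr_ge0 ?sqr_ge0 //; lra.
move: FT; rewrite /F scale0r addr0 mul0r subr0 invr1 !mul1r lerN2.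
have p0 : 0 < 1 - T * r by rewrite subr_gt0.
by rewrite -expr2 exprVn mulrC ler_pdivlMr ?exprn_gt0 // mulrC.
Qed.

Lemma hess_form_segment_le T v : 0 <= T -> T * r < 1 ->
  (forall t, 0 <= t <= T -> D (x + t *: d)) ->
  hess_form (x + T *: d) v v <= hess_form x v v / (1 - T * r) ^+ 2.
Proof.
move=> T0 Tr inD.
have tr t : 0 <= t <= T -> t * r < 1.
  by move=> /andP[_ tT]; apply: le_lt_trans Tr; rewrite ler_wpM2r.
pose F t := (1 - t * r) * (1 - t * r) * hess_form (x + t *: d) v v.
have FT : F T <= F 0.
  apply: (@le0_derive_le R F (fun t => ((1 - t * r) * (1 - t * r)) * third_form (x + t *: d) d v v
     + hess_form (x + t *: d) v v * ((1 - t * r) * (- r) + (1 - t * r) * (- r)))) => [//|t tT|t tT].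
    have d1 := is_derive_1Bmul r t.
    exact: is_deriveM (is_deriveM d1 d1) (is_derive_hess_form_line v v (inD _ tT)).
  have := @third_form_segment_le t v; case/andP: (tT) => t0 tT' /(_ t0 (tr _ tT)).
  move=> /(_ _)/wrap[]; first by move=> s /andP[s0 st]; apply: inD; rewrite s0 (le_trans st).
  rewrite ler_norml => /andP[_ +].
  have u0 : 0 < 1 - t * r by rewrite subr_gt0 tr.
  move: (1 - t * r) u0 (third_form _ _ _ _) (hess_form _ _ _) => u u0 th h H.
  have -> : u * u * th + h * (u * - r + u * - r) = u ^+ 2 * (th - 2 * (r / u) * h).
    by field; rewrite gt_eqF.
  by rewrite mulr_ge0_le0 ?sqr_ge0 //; lra.
move: FT; rewrite /F scale0r addr0 mul0r subr0 !mul1r.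
have p0 : 0 < 1 - T * r by rewrite subr_gt0.
by rewrite -expr2 mulrC ler_pdivlMr ?exprn_gt0.
Qed.

End Segment.

(** The second derivative of t |-> v.g(x + t d) is D^3 f [d, d, v], hence at most
    2 r^2 |v| / (1 - t r)^3, which is the second derivative of
    |v| / (1 - t r).  The difference of the two functions is concave. *)
Lemma gradient_segment_le x d (r : R) v : 0 <= r < 1 -> hess_form x d d = r ^+ 2 ->
  (forall t, 0 <= t <= 1 -> D (x + t *: d)) ->
  dirder v f (x + d) <=
  dirder v f x + hess_form x d v + r ^+ 2 / (1 - r) * Num.sqrt (hess_form x v v).
Proof.
move=> /andP[r0 r1] rn inD.
have Dx : D x by have := inD 0; rewrite scale0r addr0; apply; rewrite lexx ler01.
have tr t : 0 <= t <= 1 -> t * r < 1.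
  by move=> /andP[_ tT]; apply: le_lt_trans r1; rewrite ler_piMl.
have [vn vE] : exists vn : R, vn = Num.sqrt (hess_form x v v) by eexists.
have vn0 : 0 <= vn by rewrite vE.
pose F t := dirder v f (x + t *: d) - vn * (1 - t * r)^-1.
pose F' t := hess_form (x + t *: d) d v - vn * (r * (1 - t * r) ^- 2).
pose F'' t := third_form (x + t *: d) d d v
  - vn * (r * ((1 - t * r)^-1 * (r * (1 - t * r) ^- 2) + (1 - t * r)^-1 * (r * (1 - t * r) ^- 2))).
have FT : F 1 <= F 0 + 1 * F' 0.
  apply: (@le0_derive2_le R F F' F'') => [|t tT|t tT|t tT]; first exact: ler01.
  - have nz : 1 - t * r != 0 by rewrite subr_eq0 gt_eqF // tr.
    exact: is_deriveB (is_derive_dirder_f_line v (inD _ tT))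
      (is_deriveZ vn (is_derive_1Bmul_inv nz)).
  - have nz : 1 - t * r != 0 by rewrite subr_eq0 gt_eqF // tr.
    have di := is_derive_1Bmul_inv nz.
    have dd := is_deriveM di di.
    have de : (fun s : R => (1 - s * r) ^- 2) =
        (fun s => (1 - s * r)^-1) * (fun s => (1 - s * r)^-1).
      by apply/funext => s; rewrite -exprVn.
    rewrite -de in dd.
    exact: is_deriveB (is_derive_hess_form_line d v (inD _ tT)) (is_deriveZ vn (is_deriveZ r dd)).
  - have Dt := inD _ tT; case/andP: (tT) => t0 t1.
    have inDt s : 0 <= s <= t -> D (x + s *: d).
      by move=> /andP[s0 st]; apply: inD; rewrite s0 (le_trans st).
    rewrite /F'' subr_le0 third_form23 // third_form12 //.
    apply: le_trans (ler_norm _) _; apply: le_trans (third_form_mixed _ _ Dt) _.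
    have hd := hess_form_dir_le r0 rn t0 (tr _ tT) inDt.
    have hv := hess_form_segment_le r0 rn v t0 (tr _ tT) inDt.
    have u0 : 0 < (1 - t * r)^-1 by rewrite invr_gt0 subr_gt0 tr.
    have hv' : Num.sqrt (hess_form (x + t *: d) v v) <= vn * (1 - t * r)^-1.
      rewrite -[leRHS]ger0_norm ?mulr_ge0 ?(ltW u0) // -sqrtr_sqr ler_wsqrtr //.
      by rewrite exprMn vE sqr_sqrtr ?hess_form_ge0 // exprVn.
    have hd0 := hess_form_ge0 d Dt.
    have hs0 := sqrtr_ge0 (hess_form (x + t *: d) v v).
    rewrite -exprVn; move: hd; rewrite exprMn.
    move: (1 - t * r)^-1 u0 (Num.sqrt _) hv' hs0 (hess_form _ d d) hd0 => u u0 sv svu sv0 h h0 hr.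
    apply: (@le_trans _ _ (2 * (vn * u) * (r ^+ 2 * u ^+ 2))).
      by rewrite ler_pM // ?mulr_ge0 // ler_wpM2l.
    by rewrite le_eqVlt; apply/orP; left; apply/eqP; ring.
move: FT; rewrite /F /F' scale0r addr0 scale1r mul0r subr0 invr1 expr1n invr1 !mul1r !mulr1.
rewrite -vE => FT; rewrite -subr_ge0; move: FT; rewrite -subr_ge0.
congr (0 <= _); field; lra.
Qed.

(** The curvature along d is at most r^2 / (1 - T r)^2 on the whole segment. *)
Lemma value_segment_le x d (r T : R) : 0 <= r -> hess_form x d d = r ^+ 2 ->
  0 <= T -> T * r < 1 -> (forall t, 0 <= t <= T -> D (x + t *: d)) ->
  f (x + T *: d) <= f x + T * dirder d f x + T ^+ 2 * r ^+ 2 / (2 * (1 - T * r) ^+ 2).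
Proof.
move=> r0 rn T0 Tr inD.
pose C := (r / (1 - T * r)) ^+ 2.
pose F t := f (x + t *: d) - C / 2 * (t * t).
pose F' t := dirder d f (x + t *: d) - C * t.
pose F'' t := hess_form (x + t *: d) d d - C.
have FT : F T <= F 0 + T * F' 0.
  apply: (@le0_derive2_le R F F' F'') => // t tT; have Dt := inD _ tT.
  - have di : is_derive t 1 (fun s : R => s) 1 by exact: is_derive_id.
    have -> : F' t = dirder d f (x + t *: d) - C / 2 * (t * 1 + t * 1) by rewrite /F'; field.
    exact: is_deriveB (is_derive_f_line Dt) (is_deriveZ (C / 2) (is_deriveM di di)).
  - have -> : F'' t = hess_form (x + t *: d) d d - C * 1 by rewrite mulr1.
    exact: is_deriveB (is_derive_dirder_f_line d Dt) (is_deriveZ C (is_derive_id t 1)).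
  - case/andP: tT => t0 tT.
    have inDt s : 0 <= s <= t -> D (x + s *: d).
      by move=> /andP[s0 st]; apply: inD; rewrite s0 (le_trans st).
    have tr : t * r < 1 by apply: le_lt_trans Tr; rewrite ler_wpM2r.
    rewrite subr_le0; apply: le_trans (hess_form_dir_le r0 rn t0 tr inDt) _.
    have p0 : 0 < 1 - T * r by rewrite subr_gt0.
    have q0 : 0 < 1 - t * r by rewrite subr_gt0.
    rewrite /C lerXn2r ?nnegrE ?divr_ge0 ?(ltW p0) ?(ltW q0) //.
    by rewrite ler_wpM2l // lef_pV2 ?posrE // lerD2l lerN2 ler_wpM2r.
move: FT; rewrite /F /F' scale0r addr0 !mulr0 !subr0 lerBlDr.
move=> /le_trans; apply; rewrite le_eqVlt; apply/orP; left; apply/eqP.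
by rewrite /C; field; lra.
Qed.

Hypothesis D_convex : convex_set (D : set (convex_lmodType 'cV[R]_n)).
Hypothesis f_closed : closed_sublevel_sets D f.

(** The set of the good t in [0, T] is open in it.  It is also closed, because
    [value_segment_le] keeps f below a fixed level there and sublevel sets are
    closed. *)
Lemma segment_in_domain x d (r T : R) : 0 <= r -> D x -> hess_form x d d = r ^+ 2 ->
  0 <= T -> T * r < 1 -> forall t, 0 <= t <= T -> D (x + t *: d).
Proof.
move=> r0 Dx rn T0 Tr.
have line_cont : continuous (fun t : R => x + t *: d).
  by move=> t; apply: cvgD; [exact: cvg_cst | exact: scalel_continuous].
pose K := T ^+ 2 * r ^+ 2 / (2 * (1 - T * r) ^+ 2).
pose C := f x + T * `|dirder d f x| + K.
pose B := [set t : R | 0 <= t <= T /\ D (x + t *: d)].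
have BT : B = `[0, T]%classic.
  apply: (@segment_connected R 0 T).
  - by exists 0; split; rewrite ?lexx // scale0r addr0.
  - exists [set t | D (x + t *: d)]; first by move/continuousP: line_cont; exact.
    by apply/seteqP; split => t; rewrite /B /= in_itv.
  - exists ((fun t : R => x + t *: d) @^-1` [set y | D y /\ f y <= C]).
      by move/continuous_closedP: line_cont; apply; exact: f_closed.
    apply/seteqP; split=> t; rewrite /B /= in_itv /=; last by move=> [? []].
    move=> [tT Dt]; split=> //; split=> //; case/andP: (tT) => t0 tT'.
    have tr : t * r < 1 by apply: le_lt_trans Tr; rewrite ler_wpM2r.
    have inDt s : 0 <= s <= t -> D (x + s *: d) by exact: convex_line.
    apply: le_trans (value_segment_le r0 rn t0 tr inDt) _.
    rewrite /C /K lerD // ?lerD2l.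
      apply: le_trans (_ : t * `|dirder d f x| <= _); first by rewrite ler_wpM2l // ler_norm.
      by rewrite ler_wpM2r.
    have p0 : 0 < 1 - T * r by rewrite subr_gt0.
    have q0 : 0 < 1 - t * r by rewrite subr_gt0.
    have num_le : t ^+ 2 * r ^+ 2 <= T ^+ 2 * r ^+ 2.
      by rewrite ler_wpM2r ?sqr_ge0 // lerXn2r ?nnegrE.
    have den_le : (2 * (1 - t * r) ^+ 2)^-1 <= (2 * (1 - T * r) ^+ 2)^-1.
      rewrite lef_pV2 ?posrE ?mulr_gt0 ?exprn_gt0 // ler_wpM2l //.
      rewrite lerXn2r ?nnegrE ?(ltW p0) ?(ltW q0) //.
      by rewrite lerD2l lerN2 ler_wpM2r.
    apply: ler_pM num_le den_le; first by rewrite mulr_ge0 ?sqr_ge0.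
    by rewrite invr_ge0 mulr_ge0 ?sqr_ge0.
move=> t tT; have : B t by rewrite BT /= in_itv.
by case.
Qed.

Lemma dotc_gradient (g : 'cV[R]_n -> R) y v : dotc (gradient g y) v = dirder v g y.
Proof. by rewrite dotc_sum dirderE; apply: eq_bigr => i _; rewrite mxE mulrC. Qed.

Lemma dirder_delta i (g : 'cV[R]_n -> R) : dirder (delta_mx i ord0) g = partial i g.
Proof.
apply/funext => y; rewrite dirderE (bigD1 i) //= mxE !eqxx mul1r big1 ?addr0 // => j ji.
by rewrite mxE (negPf ji) mul0r.
Qed.

Lemma hessianE y i j : hessian f y i j = hess_form y (delta_mx i ord0) (delta_mx j ord0).
Proof. by rewrite /hess_form !dirder_delta mxE. Qed.

Lemma hessian_sym y : D y -> (hessian f y)^T = hessian f y.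
Proof. by move=> Dy; apply/matrixP => i j; rewrite mxE !hessianE hess_formC. Qed.

Lemma dotc_hessian y u v : D y -> dotc u (hessian f y *m v) = hess_form y u v.
Proof.
move=> Dy; rewrite dotc_sum /hess_form [in RHS]dirderE; apply: eq_bigr => i _; congr (_ * _).
rewrite -dirder_delta -/(hess_form y _ _) hess_formC // mxE /hess_form [in RHS]dirderE.
by apply: eq_bigr => j _; rewrite hessianE hess_formC // mulrC /hess_form !dirder_delta.
Qed.

Lemma hessian_unitmx y : D y -> hessian f y \in unitmx.
Proof.
move=> Dy; rewrite unitmxE unitfE; apply/det0P => -[v v0 vH].
have Hv : hessian f y *m v^T = 0 by rewrite -(hessian_sym Dy) -trmx_mul vH trmx0.
have := dotc_hessian v^T v^T Dy; rewrite Hv /dotc mulmx0 mxE => /esym/(hess_form_def Dy) vT.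
by move: v0; rewrite -[v]trmxK vT trmx0 eqxx.
Qed.

(** The Newton direction up to sign; it represents the differential of f in the
    inner product given by the Hessian. *)
Lemma newton_dual y : D y -> exists nu,
  (forall v, hess_form y nu v = dirder v f y) /\
  newton_decrement f y = Num.sqrt (hess_form y nu nu).
Proof.
move=> Dy; exists (invmx (hessian f y) *m gradient f y).
have dual v : hess_form y (invmx (hessian f y) *m gradient f y) v = dirder v f y.
  rewrite -dotc_hessian // -dotc_gradient /dotc trmx_mul trmx_inv hessian_sym //.
  by rewrite mulmxA mulmxKV ?hessian_unitmx.
by split=> //; rewrite /newton_decrement dotc_gradient dual.
Qed.

(** 0 <= |nu + d|^2 = lam^2 - 2 l^2 + |d|^2, where nu represents the differential
    of f, and |d| <= l. *)
Lemma newton_decrement_ge x d (l : R) : D x -> 0 <= l ->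
  dirder d f x = - l ^+ 2 -> hess_form x d d <= l ^+ 2 -> l <= newton_decrement f x.
Proof.
move=> Dx l0 dl hl; have [nu [nuE ->]] := newton_dual Dx.
rewrite -(ger0_norm l0) -sqrtr_sqr ler_wsqrtr //.
have hi := hess_semi_inner Dx.
have := hess_form_ge0 (nu + d) Dx.
rewrite (semi_innerDl hi) !(semi_innerDr hi) (hess_formC d nu) // (nuE d) dl; lra.
Qed.

(** The decrement at x + d is estimated on the vector v that represents the
    differential there: its square is v.g(x + d), bounded by
    [gradient_segment_le] in terms of |v| at x, and passing to the norm at x + d
    costs a factor 1 / (1 - r). *)
Lemma newton_decrement_step x d (l : R) : D x -> 0 <= l ->
  dirder d f x = - l ^+ 2 -> hess_form x d d <= l ^+ 2 ->
  newton_decrement f x < 1 ->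
  newton_decrement f (x + d) <=
  (Num.sqrt (newton_decrement f x ^+ 2 - l ^+ 2)
    + newton_decrement f x ^+ 2 / (1 - newton_decrement f x))
  / (1 - newton_decrement f x).
Proof.
move=> Dx l0 dl hl; have := newton_decrement_ge Dx l0 dl hl.
set lam := newton_decrement f x => llam lam1.
have h0 := hess_form_ge0 d Dx.
pose r := Num.sqrt (hess_form x d d).
have r0 : 0 <= r := sqrtr_ge0 _.
have rn : hess_form x d d = r ^+ 2 by rewrite sqr_sqrtr.
have rl : r <= l by rewrite -(ger0_norm l0) -sqrtr_sqr ler_wsqrtr.
have rlam := le_trans rl llam; have r1 := le_lt_trans rlam lam1.
have lam0 := le_trans r0 rlam.
have r1' : 1 * r < 1 by rewrite mul1r.
have inD := segment_in_domain r0 Dx rn ler01 r1'.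
have Dp : D (x + d) by have := inD 1; rewrite scale1r; apply; rewrite lexx ler01.
have [nu [nuE lamE]] := newton_dual Dx; rewrite -/lam in lamE.
have [v [vE ->]] := newton_dual Dp.
have hi := hess_semi_inner Dx.
set S := Num.sqrt (lam ^+ 2 - l ^+ 2).
have lam2 : lam ^+ 2 = hess_form x nu nu by rewrite lamE sqr_sqrtr // hess_form_ge0.
have gv : dirder v f (x + d) <= (S + r ^+ 2 / (1 - r)) * Num.sqrt (hess_form x v v).
  have rr : 0 <= r < 1 by rewrite r0.
  apply: le_trans (gradient_segment_le v rr rn inD) _.
  rewrite mulrDl lerD2r -(nuE v) -(semi_innerDl hi).
  apply: le_trans (semi_inner_cauchy hi _ _) _; rewrite ler_wpM2r ?sqrtr_ge0 //.
  rewrite ler_wsqrtr // (semi_innerDl hi) !(semi_innerDr hi) (hess_formC d nu) // (nuE d) dl lam2.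
  by lra.
have := hess_form_segment_ge r0 rn v ler01 r1' inD.
rewrite scale1r mul1r => hv.
rewrite -(vE v) in gv.
have S0 : 0 <= S := sqrtr_ge0 _.
have v0 := hess_form_ge0 v Dx; have vp0 := hess_form_ge0 v Dp.
have p0 : 0 < 1 - r by rewrite subr_gt0.
have q0 : 0 < 1 - lam by rewrite subr_gt0.
set L := Num.sqrt (hess_form (x + d) v v).
have L0 : 0 <= L := sqrtr_ge0 _.
have L2 : hess_form (x + d) v v = L ^+ 2 by rewrite sqr_sqrtr.
have vL : Num.sqrt (hess_form x v v) <= L / (1 - r).
  rewrite ler_pdivlMr // mulrC -[1 - r]gtr0_norm // -sqrtr_sqr -sqrtrM ?sqr_ge0 //.
  by rewrite ler_wsqrtr.
have a0 : 0 <= S + r ^+ 2 / (1 - r) by rewrite addr_ge0 ?divr_ge0 ?sqr_ge0 ?(ltW p0).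
have LL : L ^+ 2 <= (S + r ^+ 2 / (1 - r)) / (1 - r) * L.
  apply: le_trans (_ : (S + r ^+ 2 / (1 - r)) * (L / (1 - r)) <= _).
    by rewrite -L2 (le_trans gv) // (ler_wpM2l a0 vL).
  by rewrite mulrA [leLHS]mulrAC.
have Lb : L <= (S + r ^+ 2 / (1 - r)) / (1 - r).
  have [->|L_neq0] := eqVneq L 0; first by rewrite divr_ge0 ?(ltW p0).
  have L_gt0 : 0 < L by rewrite lt_neqAle eq_sym L_neq0.
  by move: LL; rewrite expr2 ler_pM2r.
apply: le_trans Lb _.
have inv_le : (1 - r)^-1 <= (1 - lam)^-1 by rewrite lef_pV2 ?posrE // lerD2l lerN2.
have inv_ge0 : 0 <= (1 - r)^-1 by rewrite invr_ge0 ltW.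
apply: (ler_pM a0 inv_ge0 _ inv_le); rewrite lerD2l.
apply: (ler_pM (sqr_ge0 r) inv_ge0 _ inv_le).
by rewrite lerXn2r ?nnegrE.
Qed.

Lemma armijo_acceptP (alpha : R) x d (t : R) :
  ~ armijo_reject D f alpha x d t <->
  D (x + t *: d) /\ f (x + t *: d) <= f x + alpha * t * dirder d f x.
Proof.
rewrite /armijo_reject /extend_pinfty -dotc_gradient; case: asboolP => Dt.
  by rewrite lte_fin; split=> [/negP|[_]]; [rewrite -leNgt | rewrite leNgt => /negP].
by rewrite ltry; split=> [/(_ isT)|[]].
Qed.

Section LineSearch.
Variables (alpha beta : R) (x d : 'cV[R]_n) (l : R).
Hypothesis alpha_itv : 0 < alpha < 1 / 2.
Hypothesis beta_itv : 0 < beta < 1.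
Hypothesis Dx : D x.
Hypothesis l_ge0 : 0 <= l.
Hypothesis slope : dirder d f x = - l ^+ 2.
Hypothesis hess_dir_le : hess_form x d d <= l ^+ 2.

(** [value_segment_le] with r replaced by the larger l; the criterion compares
    its quadratic term with (1 - alpha) t l^2. *)
Lemma armijo_accept t : 0 <= t -> t * l < 1 ->
  t <= 2 * (1 - alpha) * (1 - t * l) ^+ 2 -> ~ armijo_reject D f alpha x d t.
Proof.
move=> t0 tl tle; apply/armijo_acceptP.
have h0 := hess_form_ge0 d Dx.
pose r := Num.sqrt (hess_form x d d).
have r0 : 0 <= r := sqrtr_ge0 _.
have rn : hess_form x d d = r ^+ 2 by rewrite sqr_sqrtr.
have rl : r <= l by rewrite -(ger0_norm l_ge0) -sqrtr_sqr ler_wsqrtr.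
have tr : t * r < 1 by apply: le_lt_trans tl; rewrite ler_wpM2l.
have inD := segment_in_domain r0 Dx rn t0 tr.
split; first by apply: inD; rewrite t0 lexx.
apply: le_trans (value_segment_le r0 rn t0 tr inD) _; rewrite slope.
have p0 : 0 < 1 - t * l by rewrite subr_gt0.
have p1 : 0 < 1 - t * r by rewrite subr_gt0.
have e1 : t ^+ 2 * r ^+ 2 / (2 * (1 - t * r) ^+ 2) <= t ^+ 2 * l ^+ 2 / (2 * (1 - t * l) ^+ 2).
  have num_le : t ^+ 2 * r ^+ 2 <= t ^+ 2 * l ^+ 2.
    by rewrite ler_wpM2l ?sqr_ge0 // lerXn2r ?nnegrE.
  have den_le : (2 * (1 - t * r) ^+ 2)^-1 <= (2 * (1 - t * l) ^+ 2)^-1.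
    rewrite lef_pV2 ?posrE ?mulr_gt0 ?exprn_gt0 // ler_wpM2l //.
    rewrite lerXn2r ?nnegrE ?(ltW p0) ?(ltW p1) //.
    by rewrite lerD2l lerN2 ler_wpM2l.
  apply: ler_pM num_le den_le; first by rewrite mulr_ge0 ?sqr_ge0.
  by rewrite invr_ge0 mulr_ge0 ?sqr_ge0.
have e2 : t ^+ 2 * l ^+ 2 / (2 * (1 - t * l) ^+ 2) <= t * l ^+ 2 * (1 - alpha).
  rewrite ler_pdivrMr ?mulr_gt0 ?exprn_gt0 //.
  have := ler_wpM2l (mulr_ge0 t0 (sqr_ge0 l)) tle.
  by congr (_ <= _); ring.
by lra.
Qed.

Lemma backtracking_unit_step t : l <= (1 - 2 * alpha) / 4 ->
  backtracking_step D f alpha beta x d t -> t = 1.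
Proof.
move=> l_le [[|m] [-> _ rej]]; first by rewrite expr0.
case/andP: alpha_itv => a0 a1; have := rej 0%N isT; rewrite expr0 => rej1; exfalso.
apply: (armijo_accept ler01 _ _ rej1); rewrite mul1r; first by lra.
have : (1 + 2 * alpha) / 2 <= (1 - l) ^+ 2 by have := l_ge0; nra.
have : 0 < 1 - alpha by lra.
by nra.
Qed.

Lemma backtracking_step_ge t : backtracking_step D f alpha beta x d t ->
  beta / (4 * (1 + l)) <= t.
Proof.
case/andP: alpha_itv => a0 a1; case/andP: beta_itv => b0 b1.
have l1 : 0 < 4 * (1 + l) by have := l_ge0; lra.
move=> [[|m] [-> _ rej]].
  by rewrite expr0 ler_pdivrMr // mul1r; have := l_ge0; lra.
rewrite exprS ler_wpM2l ?(ltW b0) // leNgt; apply/negP => small.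
have t0 : 0 <= beta ^+ m by rewrite exprn_ge0 // ltW.
have {small} : beta ^+ m * (4 * (1 + l)) < 1 by rewrite -ltr_pdivlMr // mul1r.
move: (beta ^+ m) t0 (rej m (leqnn _)) => u u0 rejm small.
have ul : u * l <= 1 / 4 by have := l_ge0; nra.
have u4 : u <= 1 / 4 by have := l_ge0; nra.
apply: (armijo_accept u0 _ _ rejm); first by lra.
by nra.
Qed.

Lemma backtracking_decrease t c : 0 < c -> c <= l ->
  backtracking_step D f alpha beta x d t ->
  f (x + t *: d) - f x <= - (alpha * beta * c ^+ 2 / (4 * (1 + c))).
Proof.
case/andP: (alpha_itv) => a0 a1; case/andP: (beta_itv) => b0 b1.
move=> c0 cl bt; have t_ge := backtracking_step_ge bt.
have [m [_ /armijo_acceptP[_ dec] _]] := bt; rewrite slope in dec.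
have c1 : 0 < 4 * (1 + c) by lra.
have l1 : 0 < 4 * (1 + l) by lra.
have : beta * (c ^+ 2 / (4 * (1 + c))) <= t * l ^+ 2.
  apply: (@le_trans _ _ (beta / (4 * (1 + l)) * l ^+ 2)); last by rewrite ler_wpM2r ?sqr_ge0.
  rewrite -[leRHS]mulrA ler_wpM2l ?(ltW b0) // [leRHS]mulrC.
  rewrite ler_pdivlMr // mulrAC ler_pdivrMr //.
  have : 0 <= (l - c) * (l + c + l * c) by rewrite mulr_ge0 ?subr_ge0 ?addr_ge0 ?mulr_ge0 ?(ltW c0).
  by lra.
move=> /(ler_wpM2l (ltW a0)); rewrite !mulrA in dec *; lra.
Qed.

End LineSearch.

End SelfConcordant.

(** * Constants and the theorem *)

Section Constants.
Context {R : realType}.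
Implicit Types (e m : R^nat).

(** The lower bound of all eps_k mu_k^2 that the two infima provide. *)
Definition ratio_bound e m : R := inf (range e) * inf (range m) ^+ 2.

(** The three bounds make the composite factor less than 1, the unit step
    acceptable, and the threshold less than (3 - sqrt 5) / 2. *)
Definition switch_threshold (alpha : R) e m : R :=
  Num.min (Num.min ((1 - Num.sqrt (1 - ratio_bound e m)) / 3) ((1 - 2 * alpha) / 4))
    (1 / 4).

(** Here c bounds the reduced decrement from below as long as the Newton
    decrement exceeds the threshold. *)
Definition guaranteed_decrease (alpha beta : R) e m : R :=
  let c := Num.sqrt (ratio_bound e m) * switch_threshold alpha e m in
  alpha * beta * c ^+ 2 / (4 * (1 + c)).

Lemma inf_range_itv (u : R^nat) : (forall k, 0 < u k <= 1) ->
  inf (range u) != 0 -> 0 < inf (range u) <= 1 /\ forall k, inf (range u) <= u k.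
Proof.
move=> u01 u0; have lb : lbound (range u) 0.
  by move=> _ [k _ <-]; have /andP[/ltW] := u01 k.
have le k : inf (range u) <= u k by apply: ge_inf; [exists 0 | exists k].
split=> //; apply/andP; split.
  by rewrite lt_neqAle eq_sym u0; apply: lb_le_inf lb; exists (u 0%N), 0%N.
by apply: le_trans (le 0%N) _; have /andP[] := u01 0%N.
Qed.

Lemma ratio_bound_itv e m : (forall k, 0 < e k <= 1) -> (forall k, 0 < m k <= 1) ->
  inf (range e) != 0 -> inf (range m) != 0 ->
  0 < ratio_bound e m <= 1 /\ forall k, ratio_bound e m <= e k * m k ^+ 2.
Proof.
move=> e01 m01 e0 m0; have [/andP[ei0 ei1] eik] := inf_range_itv e01 e0.
have [/andP[mi0 mi1] mik] := inf_range_itv m01 m0; rewrite /ratio_bound.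
split.
  by rewrite mulr_gt0 ?exprn_gt0 //= mulr_ile1 ?exprn_ile1 ?exprn_ge0 ?(ltW ei0) ?(ltW mi0).
move=> k; apply: ler_pM; rewrite ?(ltW ei0) ?exprn_ge0 ?(ltW mi0) //.
by rewrite lerXn2r ?nnegrE ?(ltW mi0) // (le_trans (ltW mi0)).
Qed.

Lemma switch_threshold_itv alpha e m : alpha < 1 / 2 -> 0 < ratio_bound e m <= 1 ->
  0 < switch_threshold alpha e m < (3 - Num.sqrt 5) / 2.
Proof.
move=> a1 /andP[c0 c1].
have q1 : Num.sqrt (1 - ratio_bound e m) < 1.
  by rewrite -[ltRHS]sqrtr1 ltr_sqrt // ltrBlDr ltrDl.
apply/andP; split; first by rewrite !lt_min; apply/andP; split; [apply/andP; split|]; lra.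
have s5 : Num.sqrt 5 < 5 / 2 :> R.
  have -> : (5 / 2 : R) = Num.sqrt ((5 / 2) ^+ 2) by rewrite sqrtr_sqr ger0_norm //; lra.
  by rewrite ltr_sqrt; lra.
apply: le_lt_trans (_ : _ <= 1 / 4) _; first by rewrite ge_min lexx orbT.
by lra.
Qed.

Lemma switch_threshold_le alpha e m lam : lam <= switch_threshold alpha e m ->
  [/\ 3 * lam <= 1 - Num.sqrt (1 - ratio_bound e m), lam <= (1 - 2 * alpha) / 4
    & lam <= 1 / 4].
Proof.
by rewrite !le_min => /andP[/andP[h1 h2] h3]; split=> //; lra.
Qed.

(** q + lam <= 1 - 2 lam < (1 - lam)^2. *)
Lemma composite_factor_lt1 (q lam : R) : 0 < lam -> lam <= 1 / 4 -> 3 * lam <= 1 - q ->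
  (q + lam) / (1 - lam) ^+ 2 < 1.
Proof.
move=> l0 l4 h; have : 0 < 1 - lam by lra.
move=> p0; rewrite ltr_pdivrMr ?exprn_gt0 // mul1r; nra.
Qed.

Lemma composite_bound (q lam s : R) : 0 <= q -> 0 < lam < 1 -> s <= q * lam ->
  (s + lam ^+ 2 / (1 - lam)) / (1 - lam) <= (q + lam) / (1 - lam) ^+ 2 * lam.
Proof.
move=> q0 /andP[l0 l1] sq; have p0 : 0 < 1 - lam by rewrite subr_gt0.
have -> : (s + lam ^+ 2 / (1 - lam)) / (1 - lam) = (s * (1 - lam) + lam ^+ 2) / (1 - lam) ^+ 2.
  by field; rewrite gt_eqF.
rewrite mulrAC ler_wpM2r ?invr_ge0 ?sqr_ge0 //; nra.
Qed.

End Constants.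

Theorem theorem3p2 (R : realType) (n N p : nat)
    (p_ge1 : (1 <= p)%N) (p_lt_N : (p < N)%N) (N_lt_n : (N < n)%N)
    (* the objective function *)
    (D : set 'cV[R]_n) (f : 'cV[R]_n -> R)
    (D_open : open D)
    (D_convex : convex_set (D : set (convex_lmodType 'cV[R]_n)))
    (f_C3 : C_on 3 D f)
    (f_strict : strictly_convex_on D f)
    (f_sc : self_concordant_on D f)
    (f_closed : closed_sublevel_sets D f)
    (f_bounded : has_lbound (f @` D))
    (* line search parameters *)
    (alpha beta : R)
    (alpha_itv : 0 < alpha < 1 / 2) (beta_itv : 0 < beta < 1)
    (* the random process *)
    (d : measure_display) (Omega : measurableType d) (P : probability Omega R)
    (s : nat -> Omega -> 'I_N -> 'I_n)
    (s_unif : forall k, uniform_without_replacement P (s k))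
    (x0 : 'cV[R]_n) (x0_D : D x0)
    (x : nat -> Omega -> 'cV[R]_n)
    (sigma : nat -> Omega -> seq R)
    (U : nat -> Omega -> 'M[R]_(N, p))
    (t : nat -> Omega -> R)
    (Qinv := fun k w => Qh_inv (s k w) (sigma k w) (U k w))
    (lam := fun k w => newton_decrement f (x k w))
    (lamh := fun k w =>
       reduced_decrement f (x k w) (s k w) (sigma k w) (U k w))
    (sigma_eig : forall k w,
       sorted_eigenvalues (reduced_hessian f (x k w) (s k w)) (sigma k w))
    (sigma_gt0 : forall k w i, (i < N)%N -> 0 < (sigma k w)`_i)
    (U_eig : forall k w,
       top_eigenvectors (reduced_hessian f (x k w) (s k w))
                        (sigma k w) (U k w))
    (t_ls : forall k w,
       backtracking_step D f alpha beta (x k w)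
         (- (Qinv k w *m gradient f (x k w))) (t k w))
    (x_init : forall w, x 0%N w = x0)
    (x_next : forall k w,
       x k.+1 w = x k w - t k w *: (Qinv k w *m gradient f (x k w)))
    (* on {lamh k > 0}, an event of probability delta *)
    (delta : R) (delta_gt0 : 0 < delta)
    (lamh_gt0 : forall k,
       has_probability P [set w | 0 < lamh k w] delta)
    (mu : nat -> Omega -> R)
    (mu_itv : forall k w, 0 < mu k w <= 1)
    (eps := fun k w => eigenvalue_ratio (N := N) p (sigma k w))
    (mu_def : forall k w, 0 < lamh k w ->
       Num.sqrt (lam k w ^+ 2 - lamh k w ^+ 2)
         <= Num.sqrt (1 - eps k w * mu k w ^+ 2) * lam k w)
    (eps_min := fun w => inf (range (eps ^~ w)))
    (mu_min := fun w => inf (range (mu ^~ w)))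
    (eps_bar := fun w => limn_inf (eps ^~ w))
    (mu_bar := fun w => limn_inf (mu ^~ w))
    (eps_min_neq0 : forall w, eps_min w != 0)
    (mu_min_neq0 : forall w, mu_min w != 0) :
  (* the constants may depend on the sequences (eps_k) and (mu_k) *)
  exists gammah etah : R^nat -> R^nat -> R,
  let gam := fun w => gammah (eps ^~ w) (mu ^~ w) in
  let eta := fun w => etah (eps ^~ w) (mu ^~ w) in
  (forall w, 0 < gam w /\ 0 < eta w < (3 - Num.sqrt 5) / 2) /\
  forall k,
    has_probability P [set w | 0 < lamh k w] delta /\
    forall w, 0 < lamh k w ->
      (eta w < lam k w -> f (x k.+1 w) - f (x k w) <= - gam w) /\
      (lam k w <= eta w ->
         ((0 < eps_bar w < 1 \/ 0 < mu_bar w < 1) ->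
            lam k.+1 w <=
              (Num.sqrt (1 - eps_min w * mu_min w ^+ 2) + lam k w)
                / (1 - lam k w) ^+ 2 * lam k w /\
            (Num.sqrt (1 - eps_min w * mu_min w ^+ 2) + lam k w)
                / (1 - lam k w) ^+ 2 * lam k w < lam k w) /\
         (eps_bar w = 1 /\ mu_bar w = 1 ->
            lam k.+1 w / lam k w <=
              (Num.sqrt (1 - eps k w * mu k w ^+ 2) + lam k w)
                / (1 - lam k w) ^+ 2)).
Proof.
pose dir k w := - (Qinv k w *m gradient f (x k w)).
have x_step k w : x k.+1 w = x k w + t k w *: dir k w by rewrite x_next scalerN.
have xD k w : D (x k w).
  elim: k => [|k IH]; first by rewrite x_init.
  have [m [_ acc _]] := t_ls k w; rewrite x_step.
  by have /armijo_acceptP[] := acc.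
have lamh_ge0 k w : 0 <= lamh k w := sqrtr_ge0 _.
have lamh2 k w : 0 < lamh k w ->
    dotc (gradient f (x k w)) (Qinv k w *m gradient f (x k w)) = lamh k w ^+ 2.
  move=> pos; rewrite sqr_sqrtr // ltW //.
  by move: pos; rewrite /lamh /reduced_decrement sqrtr_gt0.
have slope k w : 0 < lamh k w -> dirder (dir k w) f (x k w) = - lamh k w ^+ 2.
  by move=> /lamh2 <-; rewrite -dotc_gradient /dir -scaleN1r dotcZr mulN1r.
have hess_sym k w : (hessian f (x k w))^T = hessian f (x k w).
  exact: (hessian_sym D_open f_C3 (xD k w)).
have hess_dir k w : 0 < lamh k w ->
    hess_form f (x k w) (dir k w) (dir k w) <= lamh k w ^+ 2.
  move=> /lamh2 <-; rewrite (hess_formNN D_open f_C3 _ (xD k w)).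
  rewrite -(dotc_hessian D_open f_C3 _ _ (xD k w)).
  exact: (Qh_inv_energy_le p_lt_N (hess_sym k w) (sigma_eig k w) (sigma_gt0 k w) (U_eig k w)).
have eps_itv k w : 0 < eps k w <= 1.
  rewrite (eigenvalue_ratio_gt0 p_lt_N (sigma_gt0 k w)).
  exact: (eigenvalue_ratio_le1 p_lt_N (sigma_eig k w) (sigma_gt0 k w)).
have rb w := ratio_bound_itv (eps_itv ^~ w) (mu_itv ^~ w) (eps_min_neq0 w) (mu_min_neq0 w).
exists (guaranteed_decrease alpha beta), (switch_threshold alpha) => gam eta.
have [a0 a1] := andP alpha_itv; have [b0 b1] := andP beta_itv.
have eta_itv w : 0 < eta w < (3 - Num.sqrt 5) / 2.
  by apply: switch_threshold_itv => //; have [] := rb w.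
pose c w := Num.sqrt (ratio_bound (eps ^~ w) (mu ^~ w)) * eta w.
have c_gt0 w : 0 < c w.
  by have [/andP[r0 _] _] := rb w; have /andP[e0 _] := eta_itv w; rewrite mulr_gt0 ?sqrtr_gt0.
split=> [w|k].
  split=> //; have c0 := c_gt0 w.
  have c1 : 0 < 4 * (1 + c w) by lra.
  by apply: (divr_gt0 _ c1); apply: mulr_gt0; [exact: mulr_gt0 | exact: exprn_gt0].
split=> // w lamh_pos.
have [/andP[r0 r1] rk] := rb w; have /andP[e0 _] := eta_itv w.
have lam_ge := newton_decrement_ge D_open f_C3 f_strict f_sc (xD k w) (lamh_ge0 k w)
  (slope k w lamh_pos) (hess_dir k w lamh_pos).
rewrite -/(lam k w) in lam_ge.
have lam_gt0 : 0 < lam k w := lt_le_trans lamh_pos lam_ge.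
pose q := Num.sqrt (1 - eps k w * mu k w ^+ 2).
have q0 : 0 <= q := sqrtr_ge0 _.
have rk1 : eps k w * mu k w ^+ 2 <= 1.
  have /andP[ek0 ek1] := eps_itv k w; have /andP[mk0 mk1] := mu_itv k w.
  by rewrite mulr_ile1 ?exprn_ile1 ?exprn_ge0 ?(ltW ek0) ?(ltW mk0).
have q2 : q ^+ 2 = 1 - eps k w * mu k w ^+ 2 by rewrite sqr_sqrtr // subr_ge0.
have mu_sq : ratio_bound (eps ^~ w) (mu ^~ w) * lam k w ^+ 2 <= lamh k w ^+ 2.
  apply: (@le_trans _ _ (eps k w * mu k w ^+ 2 * lam k w ^+ 2)).
    by rewrite ler_wpM2r ?sqr_ge0.
  have := mu_def k w lamh_pos; rewrite -/q => H.
  have dif : 0 <= lam k w ^+ 2 - lamh k w ^+ 2.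
    by rewrite subr_ge0 lerXn2r ?nnegrE ?(ltW lam_gt0).
  have : Num.sqrt (lam k w ^+ 2 - lamh k w ^+ 2) ^+ 2 <= (q * lam k w) ^+ 2.
    by rewrite lerXn2r ?nnegrE ?mulr_ge0 ?sqrtr_ge0 ?(ltW lam_gt0).
  rewrite (sqr_sqrtr dif) exprMn q2; lra.
split=> [lam_gt|lam_le].
  rewrite x_step; apply: (backtracking_decrease D_open f_C3 f_strict f_sc D_convex f_closed
    alpha_itv beta_itv (xD k w) (lamh_ge0 k w) (slope k w lamh_pos) (hess_dir k w lamh_pos)
    (c_gt0 w) _ (t_ls k w)).
  rewrite -(ger0_norm (lamh_ge0 k w)) -sqrtr_sqr.
  rewrite -(ger0_norm (ltW (c_gt0 w))) -sqrtr_sqr ler_wsqrtr // /c exprMn sqr_sqrtr ?(ltW r0) //.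
  apply: le_trans mu_sq; rewrite ler_wpM2l ?(ltW r0) // lerXn2r ?nnegrE ?(ltW e0) ?(ltW lam_gt0) //.
  exact: ltW.
have [l3 la l4] := switch_threshold_le lam_le.
have tk1 : t k w = 1.
  apply: (backtracking_unit_step D_open f_C3 f_strict f_sc D_convex f_closed
    alpha_itv (xD k w) (lamh_ge0 k w) (slope k w lamh_pos) (hess_dir k w lamh_pos) _ (t_ls k w)).
  exact: le_trans lam_ge la.
have lam1 : 0 < lam k w < 1 by apply/andP; split; lra.
have bound : lam k.+1 w <= (q + lam k w) / (1 - lam k w) ^+ 2 * lam k w.
  apply: le_trans (composite_bound q0 lam1 (mu_def k w lamh_pos)).
  rewrite /lam x_step tk1 scale1r.
  apply: (newton_decrement_step D_open f_C3 f_strict f_sc D_convex f_closed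
    (xD k w) (lamh_ge0 k w) (slope k w lamh_pos) (hess_dir k w lamh_pos)).
  by case/andP: lam1.
split=> [_|_]; last by rewrite ler_pdivrMr.
have qq : q <= Num.sqrt (1 - eps_min w * mu_min w ^+ 2).
  by rewrite ler_wsqrtr // lerD2l lerN2; exact: rk.
split.
  apply: le_trans bound _; rewrite ler_wpM2r ?(ltW lam_gt0) // ler_wpM2r ?invr_ge0 ?sqr_ge0 //.
  by rewrite lerD2r.
by rewrite gtr_pMl //; exact: composite_factor_lt1.
Qed.
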